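(* Let $b,c$ be positive integers. For every $(a_1,a_2)\in\mathbb{Z}^2$, the greedy element $x[a_1,a_2]\in\mathcal{A}(b,c)$ at $(a_1,a_2)$ is given by $$x[a_1,a_2]=x_1^{-a_1}x_2^{-a_2}\sum_{(S_1,S_2)}x_1^{b|S_2|}x_2^{c|S_1|},$$ where the sum is over all compatible pairs $(S_1,S_2)$ in $\mathcal{D}^{[a_1]_+\times[a_2]_+}$, with $[a]_+=\max(a,0)$.
   Context: Cluster algebra. Fix positive integers $b,c$. Let $\mathcal{F}=\mathbb{Q}(x_1,x_2)$ and define $x_m\in\mathcal{F}$ for all $m\in\mathbb{Z}$ by $x_{m-1}x_{m+1}=x_m^b+1$ for $m$ odd and $x_{m-1}x_{m+1}=x_m^c+1$ for $m$ even. $\mathcal{A}(b,c)$ is the subring of $\mathcal{F}$ generated by all $x_m$. Greedy elements. Conventions: $\binom{a}{k}=0$ unless $0\le k\le a$; an empty sum is $0$. An element $x\in\mathcal{A}(b,c)$ is pointed at $(a_1,a_2)\in\mathbb{Z}^2$ if $x=x_1^{-a_1}x_2^{-a_2}\sum_{p,q\ge0}c(p,q)x_1^{bp}x_2^{cq}$ with $c(p,q)\in\mathbb{Z}$ (finitely many nonzero) and $c(0,0)=1$. It is greedy at $(a_1,a_2)$ if moreover $$c(p,q)=\max\left(\sum_{k=1}^p(-1)^{k-1}c(p-k,q)\binom{a_2-cq+k-1}{k},\ \sum_{k=1}^q(-1)^{k-1}c(p,q-k)\binom{a_1-bp+k-1}{k}\right)$$ for every nonzero $(p,q)\in\mathbb{Z}_{\ge0}^2$.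 For each $(a_1,a_2)$ there is a unique greedy element, denoted $x[a_1,a_2]$. Dyck paths. Let $(a_1,a_2)$ be a pair of nonnegative integers. A Dyck path of type $a_1\times a_2$ is a lattice path (unit steps East and North) from $(0,0)$ to $(a_1,a_2)$ that never goes above the main diagonal joining $(0,0)$ and $(a_1,a_2)$. The maximal one $\mathcal{D}=\mathcal{D}^{a_1\times a_2}$ is the unique one such that any lattice point strictly above $\mathcal{D}$ is also strictly above the main diagonal. Let $\mathcal{D}_1=\{u_1,\dots,u_{a_1}\}$ be the set of horizontal edges of $\mathcal{D}$ indexed left to right, and $\mathcal{D}_2=\{v_1,\dots,v_{a_2}\}$ the set of vertical edges indexed bottom to top. For points $A,B$ on $\mathcal{D}$, $AB$ is the subpath starting from $A$ and going in the Northeast direction until it reaches $B$ (if $(a_1,a_2)$ is reached first, continue from $(0,0)$); by convention $AA$ is the full path that starts at $A$, passes $(a_1,a_2)$, and ends at $A$. The points $(0,0)$ and $(a_1,a_2)$ are regarded as the same point. $(AB)_1$ and $(AB)_2$ are the sets of horizontal, respectively vertical, edges in $AB$. $AB^\circ$ is the set of lattice points on the subpath $AB$ excluding the endpoints $A$ and $B$. Compatibility. For $S_1\subseteq\mathcal{D}_1$, $S_2\subseteq\mathcal{D}_2$, the pair $(S_1,S_2)$ is compatible if for every $u\in S_1$ and $v\in S_2$, denoting by $E$ the left endpoint of $u$ and by $F$ the upper endpoint of $v$, there exists a lattice point $A\in EF^\circ$ such that $$|(AF)_1|=b\,|(AF)_2\cap S_2|\quad\text{or}\quad|(EA)_2|=c\,|(EA)_1\cap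 S_1|.$$ *)

(* Defs.v *)
From HB Require Import structures.
From mathcomp Require Import all_boot all_order all_algebra.
From mathcomp Require Import mpoly zify.

Set Implicit Arguments.
Unset Strict Implicit.
Unset Printing Implicit Defensive.

Import Order.TTheory GRing.Theory Num.Theory.
Local Open Scope ring_scope.

(* The ambient field Q(x_1, x_2). *)
Notation QX := {fraction {mpoly rat[2]}}.

Definition x1 : QX := tofrac ('X_ord0 : {mpoly rat[2]}).
Definition x2 : QX := tofrac ('X_ord_max : {mpoly rat[2]}).

Section ClusterAlgebra.
Variables b c : nat.

Definition exch_exp (m : int) : nat := if odd `|m|%N then b else c.

(* [cluster_fwd n] is (x_(1+n), x_(2+n)); [cluster_bwd n] is (x_(1-n), x_(2-n)). *)
Fixpoint cluster_fwd (n : nat) : QX * QX :=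
  if n is n'.+1 then
    let: (y, z) := cluster_fwd n' in (z, (z ^+ exch_exp (n'.+2)%:Z + 1) / y)
  else (x1, x2).

Fixpoint cluster_bwd (n : nat) : QX * QX :=
  if n is n'.+1 then
    let: (y, z) := cluster_bwd n' in
    ((y ^+ exch_exp (1 - n'%:Z) + 1) / z, y)
  else (x1, x2).

Definition cluster_var (m : int) : QX :=
  match m with
  | Posz n => if n is n'.+1 then (cluster_fwd n').1 else (cluster_bwd 1).1
  | Negz n => (cluster_bwd n.+2).1
  end.

End ClusterAlgebra.

(* Divisions in [cluster_var] are by nonzero elements: every x_m is a quotient
   of polynomials that are positive at (1, 1). *)
Definition posf (f : QX) := exists P Q : {mpoly rat[2]},
  [/\ f = tofrac P / tofrac Q, 0 < P.@[fun=> 1] & 0 < Q.@[fun=> 1]].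

Lemma tofrac_pos_neq0 (P : {mpoly rat[2]}) : 0 < P.@[fun=> 1] -> tofrac P != 0 :> QX.
Proof. by rewrite tofrac_eq0; apply: contraTneq => ->; rewrite meval0 ltxx. Qed.
Lemma posf_neq0 f : posf f -> f != 0.
Proof. by case=> P [Q [-> p q]]; rewrite mulf_neq0 ?invr_eq0 ?tofrac_pos_neq0. Qed.
Lemma posf_poly P : 0 < P.@[fun=> 1] -> posf (tofrac P).
Proof. by move=> p; exists P, 1; rewrite tofrac1 divr1 meval1 ltr01. Qed.
Lemma posfM f g : posf f -> posf g -> posf (f * g).
Proof.
case=> P [Q [-> p q]] [P' [Q' [-> p' q']]]; exists (P * P'), (Q * Q').
by rewrite !mevalM !mulr_gt0 // !tofracM mulf_div.
Qed.
Lemma posfV f : posf f -> posf f^-1.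
Proof. by case=> P [Q [-> p q]]; exists Q, P; rewrite invf_div. Qed.
Lemma posfD1 f : posf f -> posf (f + 1).
Proof.
case=> P [Q [-> p q]]; exists (P + Q), Q.
by rewrite mevalD addr_gt0 // tofracD mulrDl divff ?tofrac_pos_neq0.
Qed.
Lemma posfX f n : posf f -> posf (f ^+ n).
Proof.
move=> pf; elim: n => [|n IH]; last by rewrite exprS; apply: posfM.
by rewrite expr0 -tofrac1; apply: posf_poly; rewrite meval1.
Qed.
Lemma posf_x1 : posf x1. Proof. by apply: posf_poly; rewrite mevalXU. Qed.
Lemma posf_x2 : posf x2. Proof. by apply: posf_poly; rewrite mevalXU. Qed.

Lemma posf_fwd b c n : posf (cluster_fwd b c n).1 /\ posf (cluster_fwd b c n).2.
Proof.
elim: n => [|n] /=; first by split; [apply: posf_x1|apply: posf_x2].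
by case: cluster_fwd => y z /= [py pz]; split=> //; apply/posfM/posfV/py/posfD1/posfX.
Qed.
Lemma posf_bwd b c n : posf (cluster_bwd b c n).1 /\ posf (cluster_bwd b c n).2.
Proof.
elim: n => [|n] /=; first by split; [apply: posf_x1|apply: posf_x2].
by case: cluster_bwd => y z /= [py pz]; split=> //; apply/posfM/posfV/pz/posfD1/posfX.
Qed.

Lemma cluster_fwdE b c n : cluster_fwd b c n = (cluster_var b c (1 + n%:Z), cluster_var b c (2 + n%:Z)).
Proof.
have -> : 1 + n%:Z = Posz n.+1 by lia.
have -> : 2 + n%:Z = Posz n.+2 by lia.
rewrite [cluster_var b c n.+1]/cluster_var [cluster_var b c n.+2]/cluster_var.
by rewrite [cluster_fwd b c n.+1]/=; case: cluster_fwd.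
Qed.
Lemma cluster_bwd1 b c n : (cluster_bwd b c n).1 = cluster_var b c (1 - n%:Z).
Proof. 
case: n => [|[|n]] //. by have -> : 1 - n.+2%:Z = Negz n by lia.
Qed.
Lemma cluster_bwdE b c n : cluster_bwd b c n = (cluster_var b c (1 - n%:Z), cluster_var b c (2 - n%:Z)).
Proof.
rewrite [LHS]surjective_pairing cluster_bwd1; congr (_, _).
case: n => [|n] //=.
have -> : 2 - n.+1%:Z = 1 - n%:Z by lia.
by rewrite -cluster_bwd1; case: cluster_bwd.
Qed.

Lemma cluster_var_exchange (b c : nat) (m : int) :
  cluster_var b c (m - 1) * cluster_var b c (m + 1) =
  cluster_var b c m ^+ (if odd `|m|%N then b else c) + 1.
Proof.
case: (leP 2 m) => [m2|m2].
  have [n mE] : exists n : nat, m = 2 + n%:Z by exists `|m - 2|%N; lia.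
  have fS : (cluster_fwd b c n.+1).2 = ((cluster_fwd b c n).2 ^+ exch_exp b c (n.+2)%:Z + 1) / (cluster_fwd b c n).1 by rewrite /=; case: cluster_fwd.
  move: fS; rewrite !cluster_fwdE /fst /snd.
  have [] := posf_fwd b c n; rewrite cluster_fwdE /fst /snd => /posf_neq0 nz _.
  have -> : 2 + n.+1%:Z = m + 1 by lia.
  have -> : Posz n.+2 = m by lia.
  rewrite -mE => ->; have <- : 1 + n%:Z = m - 1 by lia.
  by rewrite mulrCA divff // mulr1.
have [n mE] : exists n : nat, m = 1 - n%:Z by exists `|1 - m|%N; lia.
have E : (cluster_bwd b c n.+1).1 = ((cluster_bwd b c n).1 ^+ exch_exp b c (1 - n%:Z) + 1) / (cluster_bwd b c n).2 by rewrite /=; case: cluster_bwd.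
move: E; rewrite !cluster_bwdE /fst /snd => E.
have [] := posf_bwd b c n; rewrite cluster_bwdE /fst /snd => _ /posf_neq0.
have -> : 2 - n%:Z = m + 1 by lia.
have <- : 1 - n.+1%:Z = m - 1 by lia.
move=> nz; rewrite E.
have -> : 2 - n%:Z = m + 1 by lia.
by rewrite -mE divfK.
Qed.
Lemma cluster_var1 b c : cluster_var b c 1 = x1. Proof. by []. Qed.
Lemma cluster_var2 b c : cluster_var b c 2 = x2. Proof. by []. Qed.

Inductive subring_gen (R : pzRingType) (G : R -> Prop) : R -> Prop :=
| subring_gen_in x of G x : subring_gen G x
| subring_gen1 : subring_gen G 1
| subring_genB x y of subring_gen G x & subring_gen G y : subring_gen G (x - y)
| subring_genM x y of subring_gen G x & subring_gen G y : subring_gen G (x * y).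

Definition cluster_algebra (b c : nat) : QX -> Prop :=
  subring_gen (fun y => exists m : int, y = cluster_var b c m).

(* The convention is that binom(a, k) = 0 unless 0 <= k <= a; in particular it
   vanishes for every negative a. *)
Definition binz (a : int) (k : nat) : int :=
  if a is Posz n then ('C(n, k))%:Z else 0.

(* [x] is an element of A(b,c) pointed at (a1, a2), with coefficients [e p q];
   the bound [N] expresses that only finitely many of them are nonzero. *)
Definition pointed_with (b c : nat) (a1 a2 : int) (e : nat -> nat -> int)
    (x : QX) : Prop :=
  [/\ cluster_algebra b c x,
      e 0%N 0%N = 1 &
      exists N : nat,
        (forall p q : nat, (N <= p)%N || (N <= q)%N -> e p q = 0) /\
        x = x1 ^ (- a1) * x2 ^ (- a2) *
            \sum_(p < N) \sum_(q < N)
               (e p q)%:~R * x1 ^+ (b * p) * x2 ^+ (c * q)].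

Definition greedy_rec (b c : nat) (a1 a2 : int) (e : nat -> nat -> int) : Prop :=
  forall p q : nat, (p, q) != (0%N, 0%N) ->
  e p q =
    Num.max
      (\sum_(1 <= k < p.+1)
         (-1) ^+ (k - 1) * e (p - k)%N q
           * binz (a2 - (c * q)%:Z + k%:Z - 1) k)
      (\sum_(1 <= k < q.+1)
         (-1) ^+ (k - 1) * e p (q - k)%N
           * binz (a1 - (b * p)%:Z + k%:Z - 1) k).

Definition greedy (b c : nat) (a1 a2 : int) (x : QX) : Prop :=
  exists e : nat -> nat -> int,
    pointed_with b c a1 a2 e x /\ greedy_rec b c a1 a2 e.

(* A lattice path with n steps is a word [D : n.-tuple bool], [true] standing
   for a North step and [false] for an East step. *)

(* The lattice point reached after k steps. *)
Definition path_point (n : nat) (D : n.-tuple bool) (k : nat) : nat * nat :=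
  (count negb (take k D), count id (take k D)).

(* For a1 > 0: (x, y) lies strictly above the line through (0, 0), (a1, a2). *)
Definition above_diag (a1 a2 : nat) (P : nat * nat) : bool :=
  (a2 * P.1 < a1 * P.2)%N.

Definition above_path (n : nat) (D : n.-tuple bool) (P : nat * nat) : Prop :=
  forall k : nat, (k <= n)%N ->
    (path_point D k).1 = P.1 -> ((path_point D k).2 < P.2)%N.

(* Along East/North steps it suffices to test the diagonal at lattice points. *)
Definition dyck_path (a1 a2 : nat) (D : (a1 + a2).-tuple bool) : Prop :=
  path_point D (a1 + a2) = (a1, a2) /\
  forall k : nat, (k <= a1 + a2)%N -> ~~ above_diag a1 a2 (path_point D k).

(* It suffices to consider lattice points of the rectangle: those vertically
   above it are above both the path and the diagonal. This also covers the
   degenerate rectangles a1 = 0 and a2 = 0. *)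
Definition max_dyck_path (a1 a2 : nat) (D : (a1 + a2).-tuple bool) : Prop :=
  dyck_path D /\
  forall P : nat * nat, (P.1 <= a1)%N -> (P.2 <= a2)%N ->
    above_path D P -> above_diag a1 a2 P.

Section MaxDyckPathExists.
Local Open Scope nat_scope.
Variables a1 a2 : nat.
Fixpoint max_pt (k : nat) : nat * nat := if k is k'.+1 then
  let P := max_pt k' in if a1 * P.2.+1 <= a2 * P.1 then (P.1, P.2.+1) else (P.1.+1, P.2)
  else (0, 0).
Definition max_step k := a1 * (max_pt k).2.+1 <= a2 * (max_pt k).1.
Definition max_word : (a1 + a2).-tuple bool := [tuple of mkseq max_step (a1 + a2)].
Lemma max_word_point k : k <= a1 + a2 -> path_point max_word k = max_pt k.
Proof.
rewrite /path_point /= /mkseq -map_take => kn; rewrite take_iota (minn_idPl kn).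
elim: k {kn} => [//|k IH]; rewrite -addn1 iotaD map_cat !count_cat /= add0n addn1 /=.
have -> : (if a1 * (max_pt k).2.+1 <= a2 * (max_pt k).1 then ((max_pt k).1, (max_pt k).2.+1) else ((max_pt k).1.+1, (max_pt k).2)) = (~~ max_step k + (max_pt k).1, max_step k + (max_pt k).2).
  by rewrite /max_step; case: ifP.
by rewrite -IH /= !addn0 addnC [X in (_, X)]addnC.
Qed.
Lemma max_pt_inv k : k <= a1 + a2 -> [/\ (max_pt k).1 + (max_pt k).2 = k, (max_pt k).1 <= a1, (max_pt k).2 <= a2 & a1 * (max_pt k).2 <= a2 * (max_pt k).1].
Proof.
elim: k => [|k IH] kn /=; first by rewrite !muln0.
have [] := IH (ltnW kn); case: (max_pt k) => x y /= xy xa ya dd.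
case: ifP => [H|/negbT]; [split=> //=; try lia|rewrite -ltnNge => H; split=> //=; try lia].
- case: (posnP a1) => h; first by lia.
  have := leq_mul (leqnn a2) xa; rewrite (mulnC a2 a1) => h2.
  by have := leq_trans H h2; rewrite leq_pmul2l.
- rewrite ltn_neqAle xa andbT; apply/eqP => xe.
  move: H; rewrite xe mulnC ltn_mul2l; lia.
Qed.
Lemma max_dyck_path_exists : exists D : (a1 + a2).-tuple bool, max_dyck_path D.
Proof.
exists max_word; split.
  split; last by move=> k kn; rewrite max_word_point // /above_diag -leqNgt; case: (max_pt_inv kn).
  rewrite max_word_point //; case: (max_pt_inv (leqnn (a1 + a2))); case: max_pt => x y /= *.
  by congr (_, _); lia.
move=> [x y] /= xa ya ab.
have key k : k <= a1 + a2 -> (max_pt k).1 = x -> (max_pt k).2 < y.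
  by move=> kn e; have := ab k kn; rewrite max_word_point //; apply.
have main k : k <= a1 + a2 -> x < (max_pt k).1 -> above_diag a1 a2 (x, y).
  elim: k => [//|k IH] kn /=.
  case: ifP => [_|/negbT]; first exact: IH (ltnW kn).
  rewrite -ltnNge /= => H; rewrite ltnS leq_eqVlt => /orP[/eqP e|]; last exact: IH (ltnW kn).
  rewrite /above_diag /= e; apply: leq_trans H _.
  by rewrite leq_mul2l key ?orbT // ltnW.
case: (max_pt_inv (leqnn (a1 + a2))) => h1 h2 h3 _.
case: (ltnP x a1) => xa1; first by apply: (main (a1 + a2)) => //; lia.
by have := key _ (leqnn _); lia.
Qed.
End MaxDyckPathExists.

Section Compatibility.
Variables (b c n : nat) (D : n.-tuple bool).

(* Edges and points of D are both indexed by 'I_n: edge k is the (k+1)-st step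
   and point k is its starting point, so that edge k goes from point k to point
   [ordS k]; the two ends of D are identified as point 0. *)

Definition hedges : {set 'I_n} := [set k | ~~ tnth D k].
Definition vedges : {set 'I_n} := [set k | tnth D k].

(* Number of steps from A to B going around the closed path (0 if A = B). *)
Definition cdist (A B : 'I_n) : nat := ((B + n - A) %% n)%N.

(* The edges of the subpath AB; AA is the full path. *)
Definition subpath (A B : 'I_n) : {set 'I_n} :=
  [set k | (cdist A k < (if A == B then n else cdist A B))%N].

Definition subpath1 (A B : 'I_n) : {set 'I_n} := subpath A B :&: hedges.
Definition subpath2 (A B : 'I_n) : {set 'I_n} := subpath A B :&: vedges.

(* The points of the subpath AB other than A and B: these are the starting
   points of the edges of AB, except A. *)
Definition subpath_int (A B : 'I_n) : {set 'I_n} := subpath A B :\ A.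

Definition compatible (S1 S2 : {set 'I_n}) : bool :=
  [&& S1 \subset hedges, S2 \subset vedges &
    [forall u in S1, forall v in S2,
      let E := u in let F := ordS v in
      [exists A in subpath_int E F,
         (#|subpath1 A F| == b * #|subpath2 A F :&: S2|)%N
      || (#|subpath2 E A| == c * #|subpath1 E A :&: S1|)%N]]].

End Compatibility.

Definition pos_part (a : int) : nat := `|Num.max a 0|%N.

Definition compatible_sum (b c : nat) (a1 a2 : int)
    (D : (pos_part a1 + pos_part a2).-tuple bool) : QX :=
  x1 ^ (- a1) * x2 ^ (- a2) *
  \sum_(S : {set 'I_(pos_part a1 + pos_part a2)} *
            {set 'I_(pos_part a1 + pos_part a2)} | compatible b c D S.1 S.2)
     x1 ^+ (b * #|S.2|) * x2 ^+ (c * #|S.1|).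

(* Main.v *)
Require Import Defs.
From mathcomp Require Import all_boot all_order all_algebra.
From mathcomp Require Import mpoly.
From mathcomp Require Import zify ring.

Set Implicit Arguments.
Unset Strict Implicit.
Unset Printing Implicit Defensive.

Import Order.TTheory GRing.Theory Num.Theory.
Local Open Scope ring_scope.

(** Write N(p, q) for the number of compatible pairs with |S2| = p and |S1| = q,
    and [a]_+ for the positive part of a.

    Compatibility through two walks. Lift the cyclic sequence of edges of the
    path D to the integers, with period n. Let psi rise by 1 at a vertical edge
    and fall by c at an edge of S1; let phi rise by 1 at a horizontal edge and
    fall by b at an edge of S2. For an edge i of S1 and an edge j of S2 with
    i < j < i + n, compatibility asks for some A in (i, j] with
    phi A = phi (j + 1) or psi A = psi i ([compatibleP]).

    Divisibility and positivity. Fix S1, hence psi. A vertical edge at which psi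
    reaches a new maximum is compatible with every edge of S1, and the phi side
    of the condition is never needed on a stretch that contains it; so such
    edges can be put into S2 or taken out of it at will
    ([compatible_setD_record]). There are [a2 - c |S1|]_+ of them
    ([card_record_edges]). Hence, for each q,
      sum_p N(p, q) t^p = (1 + t)^[a2 - c q]_+ * Q_q(t)
    where Q_q counts the pairs with |S1| = q such that S2 avoids these edges
    ([row_factor]). The reflection of D in its antidiagonal exchanges the two
    kinds of edges, and gives
      sum_q N(p, q) t^q = (1 + t)^[a1 - b p]_+ * R_p(t) ([col_factor]).

    The greedy recursion. Dividing by (1 + t)^m is a convolution with signed
    binomial coefficients, and it turns the recursion at (p, q) into
      min (coefficient of t^p in Q_q, coefficient of t^q in R_p) = 0
    ([greedy_rec_of_factors]). These coefficients are nonnegative. Away from the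
    origin (p, q) = (0, 0), when the first one is nonzero, the point (b p, c q)
    lies strictly to the left of the diagonal of the a1 x a2 rectangle
    ([extremal_le], [extremal_gt]); when the second one is, it lies strictly to
    the right of it. Both cannot happen. The reason for the first claim: cut the
    closed path at the running maxima of psi. Each piece is a single edge
    outside S1 and S2 or an arc that begins with an edge of S1 and ends at the
    first return of psi to its initial level. On such an arc the psi equation is
    never available, so compatibility forces phi to gain at least 1. The maximal
    Dyck path stays so close to its diagonal that this gain makes a1 c |S1| - a2
    b |S2| strictly positive on every arc. (When c |S1| > a2 there are no
    running maxima; then a whole period is one arc, and b |S2| < a1.)

    Membership in A(b, c). Let x0 and x3 be the neighbours of x1, x2, so that
    x0 x2 = 1 + x1^b and x1 x3 = 1 + x2^c. Subtracting integral multiples of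
    monomials in x0 and x3 removes the terms in which both exponents are negative
    and preserves the divisibility of the rows and columns. What remains is a sum
    of rows and columns in which (1 + x1^b)^m x2^(-m) = x0^m or
    (1 + x2^c)^m x1^(-m) = x3^m is visible ([laurent_sum_mem]).

    Uniqueness holds because the recursion determines the coefficients
    ([greedy_rec_unique]). *)

(** * Cyclic sequences lifted to the integers *)

Lemma int_step_eq (f g : int -> int) :
  f 0 = g 0 -> (forall m, f (m + 1) - f m = g (m + 1) - g m) -> f =1 g.
Proof.
move=> f0 fS; elim/int_rect => [//|k IH|k IH].
  have := fS k; have -> : k%:Z + 1 = k.+1 by lia.
  by move: IH; lia.
have := fS (- k.+1%:Z); have -> : - k.+1%:Z + 1 = - k%:Z by lia.
by move: IH; lia.
Qed.

Section CyclicLift.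
Variable n' : nat.
Local Notation n := n'.+1.

(** With integers as indices, arcs of the closed path become intervals, and the
    reversal of the path becomes the map m |-> -1 - m. *)
Definition edge (m : int) : 'I_n := inord `|(m %% n)%Z|%N.

Lemma val_edge m : edge m = `|(m %% n)%Z|%N :> nat.
Proof.
rewrite inordK //.
by have := ltz_pmod m (isT : 0 < n%:Z); have := modz_ge0 m (isT : n%:Z != 0); lia.
Qed.

Lemma edge_ord (i : 'I_n) : edge i = i.
Proof. by apply: val_inj; rewrite /= val_edge modz_small //; case: i => i /=; lia. Qed.

Lemma edgeDn m : edge (m + n%:Z) = edge m.
Proof. by rewrite /edge modzDr. Qed.

Lemma edgeDMn m k : edge (m + k * n%:Z) = edge m.
Proof. by rewrite /edge addrC modzMDl. Qed.

Lemma edge_opp m : edge (- 1 - m) = rev_ord (edge m).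
Proof.
apply: val_inj => /=; rewrite !val_edge.
have [k [r mE rn]] : exists k : int, exists2 r : nat, m = k * n%:Z + r%:Z & (r < n)%N.
  exists (m %/ n)%Z; exists `|(m %% n)%Z|%N.
    by rewrite gez0_abs ?modz_ge0 -?divz_eq.
  by have := ltz_pmod m (isT : 0 < n%:Z); have := modz_ge0 m (isT : n%:Z != 0); lia.
have -> : (m %% n)%Z = r by rewrite mE modzMDl modz_small //; lia.
suff -> : ((-1 - m) %% n)%Z = (n%:Z - 1 - r%:Z) by lia.
have -> : -1 - m = (n%:Z - 1 - r%:Z) + (- k - 1) * n%:Z by rewrite mE; ring.
by rewrite addrC modzMDl modz_small //; lia.
Qed.

(** The sum of f over the edges 0, ..., m - 1, extended to negative m in the only
    way that makes the increment from m to m + 1 equal to f (edge m) everywhere. *)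
Definition cum (f : 'I_n -> int) (m : int) : int :=
  (m %/ n)%Z * (\sum_i f i) + \sum_(i < n | (i < `|(m %% n)%Z|)%N) f i.

Lemma cum0 f : cum f 0 = 0.
Proof. by rewrite /cum div0z mod0z mul0r add0r big1. Qed.

Lemma cumS f m : cum f (m + 1) = cum f m + f (edge m).
Proof.
have [k [r mE rn]] : exists k : int, exists2 r : nat, m = k * n%:Z + r%:Z & (r < n)%N.
  exists (m %/ n)%Z; exists `|(m %% n)%Z|%N.
    by rewrite gez0_abs ?modz_ge0 -?divz_eq.
  by have := ltz_pmod m (isT : 0 < n%:Z); have := modz_ge0 m (isT : n%:Z != 0); lia.
have dE (s : nat) : (s < n)%N -> ((k * n%:Z + s%:Z) %/ n)%Z = k.
  by move=> sn; rewrite divzMDl // divz_small ?addr0 //; lia.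
have rE (s : nat) : (s < n)%N -> ((k * n%:Z + s%:Z) %% n)%Z = s.
  by move=> sn; rewrite modzMDl modz_small //; lia.
have -> : edge m = Ordinal rn by apply: val_inj; rewrite /= val_edge mE rE.
have S : \sum_(i < n | (i < r.+1)%N) f i = \sum_(i < n | (i < r)%N) f i + f (Ordinal rn).
  rewrite (bigD1 (Ordinal rn)) /= ?ltnS // addrC; congr (_ + _); apply: eq_bigl => i.
  by rewrite -val_eqE /=; lia.
rewrite mE -addrA /cum dE // rE //= -addrA -S.
have [rn1|rn1] := ltnP r.+1 n.
  have -> : r%:Z + 1 = r.+1%:Z by lia.
  by rewrite dE // rE.
have -> : k * n%:Z + (r%:Z + 1) = (k + 1) * n%:Z by nia.
rewrite mulzK // modzMl [X in _ + X]big1 // addr0 mulrDl mul1r; congr (_ + _).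
by apply: eq_bigl => i; case: i => i /= ?; lia.
Qed.

Lemma cumDn f m : cum f (m + n%:Z) = cum f m + \sum_i f i.
Proof.
have -> : m + n%:Z = 1 * n%:Z + m by lia.
by rewrite /cum divzMDl // modzMDl; ring.
Qed.

Lemma cumDMn f m k : cum f (m + k * n%:Z) = cum f m + k * \sum_i f i.
Proof. by rewrite /cum [m + _]addrC modzMDl divzMDl //; ring. Qed.

Lemma cum_rev f m : cum (fun i => f (rev_ord i)) m = - cum f (- m).
Proof.
apply: (@int_step_eq _ (fun m => - cum f (- m))) => [|{}m]; first by rewrite oppr0 !cum0.
have := cumS f (-1 - m).
have -> : -1 - m + 1 = - m by lia.
have -> : - (m + 1) = -1 - m by lia.
by rewrite cumS edge_opp; lia.
Qed.

Lemma cdist_edge (A : 'I_n) (L : nat) : (L < n)%N -> cdist A (edge (A%:Z + L%:Z)) = L.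
Proof.
move=> Ln; rewrite /cdist val_edge -PoszD modz_nat /=.
case: A => A An /=.
have [s|s] := ltnP (A + L) n.
  by rewrite (modn_small s) (_ : (_ - A)%N = (L + n)%N) ?modnDr ?modn_small //; lia.
have -> : (A + L = (A + L - n) + n)%N by lia.
rewrite modnDr (@modn_small (A + L - n)); last lia.
by rewrite (_ : (_ - A)%N = L) ?modn_small //; lia.
Qed.

Lemma edge_cdist (A k : 'I_n) : edge (A%:Z + (cdist A k)%:Z) = k.
Proof.
apply: val_inj; rewrite /= val_edge -PoszD modz_nat /= /cdist modnDmr.
case: A k => A An [k kn] /=.
by rewrite (_ : (A + _)%N = (k + n)%N) ?modnDr ?modn_small //; lia.
Qed.

Lemma cdist_lt (A k : 'I_n) : (cdist A k < n)%N.
Proof. by rewrite ltn_mod. Qed.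

Lemma sum_arc f (A : 'I_n) (L : nat) : (L <= n)%N ->
  \sum_(k | (cdist A k < L)%N) f k = cum f (A%:Z + L%:Z) - cum f A%:Z.
Proof.
elim: L => [|L IH] Ln; first by rewrite big1 // addr0 subrr.
have -> : A%:Z + L.+1%:Z = A%:Z + L%:Z + 1 by lia.
rewrite cumS (bigD1 (edge (A%:Z + L%:Z))) /= ?cdist_edge // addrC addrAC; congr (_ + _).
rewrite -IH ?(ltnW Ln) //; apply: eq_bigl => k.
have -> : (k == edge (A%:Z + L%:Z)) = (cdist A k == L).
  by apply/eqP/eqP => [->|<-]; rewrite ?cdist_edge ?edge_cdist.
by lia.
Qed.

End CyclicLift.

Lemma cum_const n' (f : 'I_n'.+1 -> int) (l r : int) : l <= r ->
  (forall j, l <= j -> j < r -> f (edge n' j) = 0) -> cum f r = cum f l.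
Proof.
move=> lr; have [d ->] : exists d : nat, r = l + d%:Z by exists `|r - l|%N; lia.
elim: d {lr} => [|d IH] f0; first by rewrite addr0.
have -> : l + d.+1%:Z = l + d%:Z + 1 by lia.
by rewrite cumS f0 ?addr0 ?IH //; try lia; move=> j *; apply: f0; lia.
Qed.

Lemma cum_eq_on n' (f g : 'I_n'.+1 -> int) (l r : int) : l <= r ->
  (forall j, l <= j -> j < r -> f (edge n' j) = g (edge n' j)) ->
  cum f r - cum f l = cum g r - cum g l.
Proof.
move=> lr fg; have cumB m : cum (fun k => f k - g k) m = cum f m - cum g m.
  by rewrite /cum !big_split /= !sumrN; ring.
have := @cum_const _ (fun k => f k - g k) l r lr; rewrite !cumB => H.
have {H} := H (fun j lj jr => eq_trans (congr1 (+%R^~ _) (fg j lj jr)) (subrr _)).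
by lia.
Qed.

(** * Compatibility expressed by two walks *)

Section Walks.
Variable n' : nat.
Local Notation n := n'.+1.
Implicit Types (A k : 'I_n) (m i j : int).

Lemma edge_lift m : exists k : int, (edge n' m)%:Z = m + k * n%:Z.
Proof.
exists (- (m %/ n)%Z); rewrite val_edge gez0_abs ?modz_ge0 //.
by have := divz_eq m n; lia.
Qed.

Lemma edge_eqDMn m L : edge n' ((edge n' m)%:Z + L) = edge n' (m + L).
Proof. by have [k ->] := edge_lift m; rewrite addrAC edgeDMn. Qed.

Lemma cdist_lift m (L : nat) : (L < n)%N -> cdist (edge n' m) (edge n' (m + L%:Z)) = L.
Proof. by move=> Ln; rewrite -edge_eqDMn cdist_edge. Qed.

Lemma edge_ordS m : ordS (edge n' m) = edge n' (m + 1).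
Proof.
by apply: val_inj; rewrite -edge_eqDMn /= [RHS]val_edge -PoszD modz_nat addn1.
Qed.

Lemma sum_arc_lift f m (L : nat) : (L <= n)%N ->
  \sum_(k | (cdist (edge n' m) k < L)%N) f k = cum f (m + L%:Z) - cum f m.
Proof.
move=> Ln; rewrite sum_arc //; have [k ->] := edge_lift m.
rewrite (_ : _ + L%:Z = m + L%:Z + k * n%:Z); last by ring.
by rewrite !cumDMn; lia.
Qed.

(** The value L = n is allowed: it is the full path from a point to itself. *)
Lemma subpath_lift m (L : nat) : (0 < L <= n)%N ->
  subpath (edge n' m) (edge n' (m + L%:Z)) = [set k | (cdist (edge n' m) k < L)%N].
Proof.
case/andP=> L0 Ln; apply/setP => k; rewrite !inE.
have [Ln1|] := ltnP L n; last first.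
  move=> nL; have -> : L = n by lia.
  by rewrite edgeDn eqxx.
rewrite cdist_lift //; case: eqP => // e.
have := cdist_lift m Ln1; have := cdist_lift m (ltn0Sn n').
by rewrite addr0 -e => -> L0'; move: L0; rewrite -L0'.
Qed.

(** For U the vertical edges, S = S1 and the fall c this is psi; for U the
    horizontal edges, S = S2 and the fall b it is phi. *)
Definition walk (U S : {set 'I_n}) (c : nat) : int -> int :=
  cum (fun k => (k \in U)%:Z - (c * (k \in S))%:Z).

Lemma walkS U S c m :
  walk U S c (m + 1) = walk U S c m + ((edge n' m \in U)%:Z - (c * (edge n' m \in S))%:Z).
Proof. exact: cumS. Qed.

Lemma sum_mem (S : {set 'I_n}) (P : pred 'I_n) :
  \sum_(k | P k) (k \in S)%:Z = #|[set k | P k] :&: S|%:Z.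
Proof.
rewrite -sum1_card (big_morph _ PoszD (erefl _)) [RHS]big_mkcond /= big_mkcond /=.
by apply: eq_bigr => k _; rewrite !inE; case: (P k); case: (k \in S).
Qed.

Lemma sum_mulmem c (S : {set 'I_n}) (P : pred 'I_n) :
  \sum_(k | P k) (c * (k \in S))%:Z = (c * #|[set k | P k] :&: S|)%:Z.
Proof. by rewrite PoszM -sum_mem mulr_sumr. Qed.

Lemma walkDMn U S c m (k : int) :
  walk U S c (m + k * n%:Z) = walk U S c m + k * (#|U|%:Z - (c * #|S|)%:Z).
Proof. by rewrite /walk cumDMn big_split /= sumrN sum_mem sum_mulmem !setTI. Qed.

Lemma walkDn U S c m : walk U S c (m + n%:Z) = walk U S c m + (#|U|%:Z - (c * #|S|)%:Z).
Proof. by have := walkDMn U S c m 1; rewrite !mul1r. Qed.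

(** An arc satisfies one of the two equations of compatibility when the gains and
    losses of the walk along it cancel. *)
Lemma arc_balance (U V S : {set 'I_n}) c m (L : nat) : S \subset V -> (0 < L <= n)%N ->
  let P := subpath (edge n' m) (edge n' (m + L%:Z)) in
  (#|P :&: U| == c * #|P :&: V :&: S|)%N = (walk U S c (m + L%:Z) == walk U S c m).
Proof.
move=> SV L0 P; have /andP[_ Ln] := L0.
rewrite /P subpath_lift // -setIA (setIidPr SV) -[X in _ = X]subr_eq0.
rewrite -sum_arc_lift // big_split /= sum_mem sumrN.
by rewrite sum_mulmem subr_eq0.
Qed.

Section CompatibilityByWalks.
Variables (D : n.-tuple bool) (b c : nat).

Definition compat_lift (S1 S2 : {set 'I_n}) := forall i j : int, i < j -> j < i + n%:Z ->
  edge n' i \in S1 -> edge n' j \in S2 -> exists2 A, i < A <= j &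
   (walk (hedges D) S2 b A = walk (hedges D) S2 b (j + 1)) \/
   (walk (vedges D) S1 c A = walk (vedges D) S1 c i).

(** The lifts i of the edge u and j of the edge v are chosen so that E is the point
    i, F the point j + 1, and the points strictly between them are i + 1, ..., j;
    this includes the case j + 1 = i + n, in which E = F. *)
Lemma compatibleP (S1 S2 : {set 'I_n}) : reflect
  [/\ S1 \subset hedges D, S2 \subset vedges D & compat_lift S1 S2]
  (compatible b c D S1 S2).
Proof.
have key i (d t : nat) : S1 \subset hedges D -> S2 \subset vedges D ->
    (0 < t <= d)%N -> (d < n)%N ->
  let E := edge n' i in let F := ordS (edge n' (i + d%:Z)) in
  let A := edge n' (i + t%:Z) in
  ((#|subpath1 D A F| == b * #|subpath2 D A F :&: S2|)%N
      || (#|subpath2 D E A| == c * #|subpath1 D E A :&: S1|)%N) =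
  (walk (hedges D) S2 b (i + t%:Z) == walk (hedges D) S2 b (i + d%:Z + 1)) ||
  (walk (vedges D) S1 c (i + t%:Z) == walk (vedges D) S1 c i).
  move=> S1h S2v /andP[t0 td] dn E F A; congr (_ || _); last first.
    by rewrite /subpath1 /subpath2 /E /A arc_balance //; lia.
  rewrite /subpath1 /subpath2 /F /A edge_ordS.
  have -> : i + d%:Z + 1 = (i + t%:Z) + (d - t).+1%:Z by lia.
  by rewrite arc_balance 1?eq_sym //; lia.
have intE i (d : nat) k : (0 < d < n)%N ->
  (k \in subpath_int (edge n' i) (ordS (edge n' (i + d%:Z)))) = (0 < cdist (edge n' i) k <= d)%N.
  move=> /andP[d0 dn]; rewrite edge_ordS; have -> : i + d%:Z + 1 = i + d.+1%:Z by lia.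
  rewrite /subpath_int subpath_lift // !inE ltnS; congr (_ && _).
  rewrite lt0n; congr (~~ _); apply/eqP/eqP => [->|e].
    by have := @cdist_lift i 0 isT; rewrite addr0.
  by rewrite -(edge_cdist (edge n' i) k) e addr0 edge_ord.
apply: (iffP and3P) => -[S1h S2v H]; split=> //.
  move=> i j ij jn iS jS.
  have [d jE] : exists d : nat, j = i + d%:Z by exists `|j - i|%N; lia.
  have d0 : (0 < d < n)%N by lia.
  have /andP[_ dn] := d0.
  move: H => /forallP/(_ (edge n' i))/implyP/(_ iS)/forallP/(_ (edge n' j))/implyP/(_ jS).
  rewrite jE => /existsP[A /andP[]]; rewrite intE //; set t := cdist _ _ => td.
  have AE : edge n' (i + t%:Z) = A by rewrite -edge_eqDMn edge_cdist.
  rewrite -AE key // => /orP W; exists (i + t%:Z); first by lia.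
  by case: W => /eqP; [left|right].
apply/forallP => u; apply/implyP => uS; apply/forallP => v; apply/implyP => vS.
pose d := cdist u v; have dn : (d < n)%N := cdist_lt _ _.
have uE : edge n' u = u by rewrite edge_ord.
have vE : edge n' (u%:Z + d%:Z) = v by rewrite edge_cdist.
have d0 : (0 < d)%N.
  rewrite lt0n; apply/negP => /eqP d0; move: vE; rewrite d0 addr0 uE => uv.
  have := subsetP S1h _ uS; have := subsetP S2v _ vS; rewrite -uv !inE.
  by move=> ->.
have [||||A AE] := H u (u%:Z + d%:Z); rewrite ?uE ?vE //; try lia.
have [t tE] : exists t : nat, A = u%:Z + t%:Z by exists `|A - u%:Z|%N; lia.
have td : (0 < t <= d)%N by lia.
have tn : (t < n)%N by lia.
move=> W; apply/existsP; exists (edge n' A).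
have := intE u d (edge n' A); rewrite uE vE => ->; last by rewrite d0.
rewrite tE cdist_edge // td /=.
have := key u d t S1h S2v td dn; rewrite /= uE vE => ->.
by rewrite -tE; case: W => ->; rewrite eqxx ?orbT.
Qed.

End CompatibilityByWalks.
End Walks.

(** * Running maxima of the walk of S1 *)

(** A discrete intermediate value theorem: a walk that rises by at most 1 cannot
    jump over the level y. *)
Lemma hit_or_below (g : int -> int) (l r y : int) :
  (forall m, g (m + 1) <= g m + 1) -> l <= r -> g l < y ->
  (forall B, l <= B -> B <= r -> g B < y) \/
  exists A, [/\ l < A, A <= r, g A = y & forall B, l <= B -> B < A -> g B < y].
Proof.
move=> gS lr gl; have [d ->] : exists d : nat, r = l + d%:Z by exists `|r - l|%N; lia.
elim: d {lr} => [|d [below|[A [lA Ad gA AB]]]].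
- by left=> B Bl Bd; have -> : B = l by lia.
- have [ye|ye] := lerP y (g (l + d.+1%:Z)).
    right; exists (l + d.+1%:Z); split=> //; first by lia.
    + have b1 : g (l + d%:Z) < y by apply: below; lia.
      move: ye (gS (l + d%:Z)) b1; rewrite (_ : l + d.+1%:Z = l + d%:Z + 1); last by lia.
      by move: (g (l + d%:Z + 1)) (g (l + d%:Z)); lia.
    + by move=> B lB Bd; apply: below; lia.
  left=> B lB Bd; have [->//|ne] := eqVneq B (l + d.+1%:Z).
  by apply: below; lia.
- by right; exists A; split=> //; lia.
Qed.

Lemma first_hit (g : int -> int) (l r y : int) :
  (forall m, g (m + 1) <= g m + 1) -> l <= r -> g l < y -> y <= g r ->
  exists A, [/\ l < A, A <= r, g A = y & forall B, l <= B -> B < A -> g B < y].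
Proof.
move=> gS lr gl yr; have [/(_ r lr (lexx r))|//] := hit_or_below gS lr gl.
by rewrite ltNge yr.
Qed.

Section FixedS1.
Variable n' : nat.
Local Notation n := n'.+1.
Variables (D : n.-tuple bool) (c : nat) (S1 : {set 'I_n}).
Local Notation E := (edge n').
Hypotheses (c0 : (0 < c)%N) (S1h : S1 \subset hedges D).
Local Notation psi := (walk (vedges D) S1 c).
Let drift : int := #|vedges D|%:Z - (c * #|S1|)%:Z.

Lemma hedgesNvedges k : (k \in hedges D) = (k \notin vedges D).
Proof. by rewrite !inE. Qed.

Lemma psi_S1 m : E m \in S1 -> psi (m + 1) = psi m - c%:Z.
Proof.
move=> mS; rewrite walkS mS muln1; have := subsetP S1h _ mS.
by rewrite hedgesNvedges => /negbTE ->; rewrite sub0r.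
Qed.

Lemma psi_v m : E m \in vedges D -> psi (m + 1) = psi m + 1.
Proof.
move=> mv; rewrite walkS mv; case: (boolP (E m \in S1)) => [/(subsetP S1h)|_].
  by rewrite hedgesNvedges mv.
by rewrite muln0 subr0.
Qed.

Lemma psi_h m : E m \in hedges D -> E m \notin S1 -> psi (m + 1) = psi m.
Proof. by rewrite hedgesNvedges walkS => /negbTE -> /negbTE ->; rewrite muln0 addr0. Qed.

Lemma psi_step m : psi (m + 1) <= psi m + 1.
Proof. by rewrite walkS; case: (_ \in vedges D) => /=; lia. Qed.

Lemma psi_shift m k : psi (m + k * n%:Z) = psi m + k * drift.
Proof. exact: walkDMn. Qed.

(** At such an edge psi rises above all the values that it takes during one period;
    for a period with positive drift this is a new maximum over the whole past. *)
Definition record_edges : {set 'I_n} :=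
  [set k in vedges D | [forall t : 'I_n, psi (k%:Z - t%:Z) <= psi k%:Z]].

Lemma record_edgesP m : reflect
  (E m \in vedges D /\ forall A, m - n%:Z < A -> A <= m -> psi A <= psi m) (E m \in record_edges).
Proof.
rewrite [E m \in record_edges]inE; apply: (iffP andP) => -[mv H]; split=> //;
  have [k kE] := edge_lift n' m.
  move=> A lA Am; have [t tE] : exists t : nat, A = m - t%:Z by exists `|m - A|%N; lia.
  have tn : (t < n)%N by lia.
  move: H => /forallP/(_ (Ordinal tn)) /=; rewrite kE psi_shift.
  by rewrite (_ : _ - t%:Z = A + k * n%:Z) ?psi_shift ?lerD2r // tE; ring.
apply/forallP => t; rewrite kE (_ : _ - t%:Z = m - t%:Z + k * n%:Z); last by ring.
by rewrite !psi_shift lerD2r; apply: H; case: t => /= *; lia.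
Qed.

Definition prefix_max m := forall A, A <= m -> psi A <= psi m.

Lemma prefix_max_record m : prefix_max m -> E m \in vedges D -> E m \in record_edges.
Proof. by move=> mt mv; apply/record_edgesP; split=> // A _ Am; apply: mt. Qed.

(** From one prefix maximum to a later one, psi proceeds by two kinds of moves: a
    single edge outside S1, or an arc that starts with an edge of S1 and ends at
    the first return of psi to its initial level. A reflexive and transitive
    relation that holds along every move therefore holds between the two maxima. *)
Lemma prefix_max_walk (R : int -> int -> Prop) :
  (forall m, R m m) -> (forall y x z, R x y -> R y z -> R x z) ->
  (forall m, prefix_max m -> E m \notin S1 -> R m (m + 1)) ->
  (forall m G, prefix_max m -> E m \in S1 -> m < G -> G <= m + n%:Z -> psi G = psi m ->
     (forall A, m < A -> A < G -> psi A < psi m) -> R m G) ->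
  forall m m', prefix_max m -> prefix_max m' -> m <= m' -> m' <= m + n%:Z -> R m m'.
Proof.
move=> R0 RT Rstep Rarc m m' mt mt' mm' mn.
have [d dE] : exists d : nat, m' - m = d%:Z by exists `|m' - m|%N; lia.
elim/ltn_ind: d m mt mm' mn dE => d IH m mt mm' mn dE.
have [->//|ne] := eqVneq m m'.
have [mS|mS] := boolP (E m \in S1); last first.
  have mS1 : psi m <= psi (m + 1).
    have [mv|] := boolP (E m \in vedges D); first by rewrite psi_v; lia.
    by rewrite -hedgesNvedges => mh; rewrite psi_h.
  apply: (RT (m + 1)); first exact: Rstep.
  apply: (IH d.-1); try lia.
  move=> A Am; have [->//|ne2] := eqVneq A (m + 1).
  by apply: le_trans mS1; apply: mt; lia.
have [|||G [mG Gm' GE GB]] := @first_hit psi (m + 1) m' (psi m) psi_step.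
- by lia.
- by rewrite psi_S1 //; lia.
- by apply: mt'; lia.
apply: (RT G).
  by apply: Rarc => //; try lia; move=> A mA AG; apply: GB; lia.
apply: (IH `|m' - G|%N); try lia.
move=> A AG; rewrite GE; have [Am|mA] := leP A m; first exact: mt.
by have [->|AG2] := eqVneq A G; [rewrite GE | apply/ltW/GB; lia].
Qed.

(** When the drift is nonnegative, earlier periods are not higher, so a maximum
    over one period is a maximum over the whole past. *)
Lemma prefix_max_exists : 0 <= drift -> exists m, prefix_max m.
Proof.
move=> d0; pose i0 : 'I_n := [arg max_(i > ord0) psi i%:Z]%O.
exists i0%:Z => A Ai; have [k kE] := edge_lift n' A.
have k0 : psi (E A)%:Z <= psi i0%:Z by rewrite /i0; case: arg_maxP => // i _; apply.
have : psi (E A)%:Z - k * drift = psi A by rewrite kE psi_shift; ring.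
have k1 : 0 <= k by case: (i0) (E A) Ai kE => i /= ilt [j /= jlt]; nia.
by have := mulr_ge0 k1 d0; lia.
Qed.

Lemma prefix_max_shift m : 0 <= drift -> prefix_max m -> prefix_max (m + n%:Z).
Proof.
move=> d0 mt A Am; have := mt (A - n%:Z).
have := psi_shift m 1; have := psi_shift (A - n%:Z) 1; rewrite !mul1r subrK => -> ->.
by rewrite lerD2r; apply; lia.
Qed.

(** Between prefix maxima psi gains 1 at each record edge and nothing on the
    other moves, so there are as many records in a period as its drift when this is positive. When
    it is not, psi was already above its value at a vertical edge k one period
    before the end of k, so k is no record. *)
Lemma card_record_edges : #|record_edges| = (#|vedges D| - c * #|S1|)%N.
Proof.
have [d0|d0] := lerP drift 0.
  suff -> : record_edges = set0 by rewrite cards0 /drift in d0 *; lia.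
  apply/setP => k; rewrite in_set0 -(edge_ord k); apply/negP => /record_edgesP[kv H].
  have := H (k%:Z + 1 - n%:Z); have := psi_v kv.
  have := psi_shift (k%:Z + 1) (-1); rewrite !mulN1r => -> ->.
  by lia.
have [m mt] := prefix_max_exists (ltW d0).
pose K : int -> int := cum (fun k => (k \in record_edges)%:Z).
suff : K (m + n%:Z) - K m = psi (m + n%:Z) - psi m.
  have := psi_shift m 1; rewrite !mul1r /K cumDn => ->.
  have aux (x y z w : int) : x + y - x = z + w - z -> y = w by lia.
  have aux2 (x y z : nat) : 0 < y%:Z - z%:Z -> x%:Z = y%:Z - z%:Z -> x = (y - z)%N by lia.
  by move/aux; rewrite sum_mem setTI => H; apply: aux2 H.
apply: (prefix_max_walk (R := fun x y => K y - K x = psi y - psi x)) => //; rewrite /K; last first.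
- by rewrite lerDl.
- exact: prefix_max_shift (ltW d0) mt.
- move=> p G pt pS pG Gn GE below.
  rewrite GE subrr (@cum_const _ _ p) ?subrr //; first exact: ltW.
  move=> j pj jG; have [->|jp] := eqVneq j p.
    case: (boolP (E p \in record_edges)) => [/record_edgesP[pv _]|//].
    by move: (subsetP S1h _ pS); rewrite hedgesNvedges pv.
  case: (boolP (E j \in record_edges)) => [/record_edgesP[_ H]|//].
  by have := H p; have := below j; lia.
- move=> p pt pS; rewrite cumS; have [pv|pv] := boolP (E p \in vedges D).
    by rewrite prefix_max_record // psi_v //; lia.
  rewrite psi_h ?hedgesNvedges //.
  by move: pv; case: (boolP (E p \in record_edges)) => [/record_edgesP[-> _]|] //; lia.
- by move=> y x z; lia.
- by move=> x; rewrite !subrr.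
Qed.

Variable b : nat.
Local Notation a1 := #|hedges D|.
Local Notation a2 := #|vedges D|.

Lemma return_or_below i j : i < j -> E i \in S1 ->
  (forall A, i < A -> A <= j -> psi A < psi i) \/
  exists A, [/\ i < A, A <= j & psi A = psi i].
Proof.
move=> ij iS; have [||H|[A [iA Aj AE _]]] := @hit_or_below psi (i + 1) j (psi i) psi_step.
- by lia.
- by rewrite psi_S1 //; lia.
- by left=> A iA Aj; apply: H; lia.
- by right; exists A; split=> //; lia.
Qed.

Lemma below_not_record i j : i < j -> j < i + n%:Z -> psi j < psi i -> E j \notin record_edges.
Proof. by move=> ij jn ji; apply/negP => /record_edgesP[_ /(_ i)]; lia. Qed.

(** Take i in S1 and j in S2. If psi returns to the level psi i between them, the
    pair is compatible whatever S2 is. Otherwise psi stays below this level up to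
    j; then no edge between i and j, nor j itself, is a record, and the increments
    of phi after i do not depend on the records in S2. *)
Lemma compatible_setD_record S2 : compatible b c D S1 S2 =
  (S2 \subset vedges D) && compatible b c D S1 (S2 :\: record_edges).
Proof.
have agree i j A : i < A -> A <= j -> j < i + n%:Z ->
      (forall B, i < B -> B <= j -> psi B < psi i) ->
    (walk (hedges D) S2 b A == walk (hedges D) S2 b (j + 1)) =
    (walk (hedges D) (S2 :\: record_edges) b A ==
     walk (hedges D) (S2 :\: record_edges) b (j + 1)).
  move=> iA Aj jn below; rewrite eq_sym -subr_eq0 [RHS]eq_sym -[RHS]subr_eq0 /walk.
  pose f k : int := (k \in hedges D)%:Z - (b * (k \in S2 :\: record_edges))%:Z.
  rewrite (@cum_eq_on _ _ f) //; first by lia.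
  move=> k Ak kj; rewrite /f in_setD (@below_not_record i) //; try lia.
  by apply: below; lia.
apply/compatibleP/andP => [[_ S2v H]|[S2v /compatibleP[_ _ H]]]; split=> //.
  apply/compatibleP; split=> //; first exact: subset_trans (subsetDl _ _) S2v.
  move=> i j ij jn iS /setDP[jS _].
  have [below|[A [iA Aj AE]]] := return_or_below ij iS; last by exists A; [lia | right].
  have [A /andP[iA Aj]] := H _ _ ij jn iS jS.
  case=> AE; exists A; rewrite ?iA //; [left | by right].
  by apply/eqP; rewrite -(agree i) // AE.
move=> i j ij jn iS jS.
have [below|[A [iA Aj AE]]] := return_or_below ij iS; last by exists A; [lia | right].
have jF : E j \in S2 :\: record_edges by rewrite in_setD jS (@below_not_record i) // below.
have [A /andP[iA Aj]] := H _ _ ij jn iS jF.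
case=> AE; exists A; rewrite ?iA //; [left | by right].
by apply/eqP; rewrite (agree i) // AE.
Qed.

(** * The slope inequality for a path close to its diagonal *)

(** At the lattice point (x, y) of the path this is a2 x - a1 y, a measure of the
    distance to the diagonal; it is periodic. *)
Definition delta m : int :=
  a2%:Z * walk (hedges D) set0 0 m - a1%:Z * walk (vedges D) set0 0 m.

(** The maximality of the path enters through this property, which is invariant
    under reversal of the path. *)
Definition balanced := forall i j, E i \in hedges D -> E j \in vedges D ->
  - a1%:Z < delta (j + 1) - delta i < a2%:Z.

Lemma delta_h m : E m \in hedges D -> delta (m + 1) = delta m + a2%:Z.
Proof.
move=> mh; have := mh; rewrite hedgesNvedges => /negbTE mv.
by rewrite /delta !walkS mh mv /=; ring.
Qed.

Lemma delta_v m : E m \in vedges D -> delta (m + 1) = delta m - a1%:Z.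
Proof.
move=> mv; have mh : (E m \in hedges D) = false by rewrite hedgesNvedges mv.
by rewrite /delta !walkS mh mv /=; ring.
Qed.

Lemma deltaDMn m k : delta (m + k * n%:Z) = delta m.
Proof. by rewrite /delta !walkDMn !mul0n; ring. Qed.

Lemma deltaDn m : delta (m + n%:Z) = delta m.
Proof. by have := deltaDMn m 1; rewrite mul1r. Qed.

Section Extremal.
Variable S2 : {set 'I_n}.
Hypotheses (S2v : S2 \subset vedges D) (cS : compat_lift D b c S1 S2).
Local Notation phi := (walk (hedges D) S2 b).

Lemma phi_h m : E m \in hedges D -> phi (m + 1) = phi m + 1.
Proof.
move=> mh; rewrite walkS mh; case: (boolP (E m \in S2)) => [/(subsetP S2v)|_].
  by move: mh; rewrite hedgesNvedges => /negbTE ->.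
by rewrite muln0 subr0.
Qed.

Lemma phi_S2 m : E m \notin S2 -> phi m <= phi (m + 1).
Proof. by move=> /negbTE mS; rewrite walkS mS muln0; lia. Qed.

(** Only an edge of S2 makes phi fall, and by hypothesis such a fall ends at a level
    that phi had already taken between l and that edge. *)
Lemma phi_jump l r : l <= r ->
  (forall j, l <= j -> j < r -> E j \in S2 -> exists A, [/\ l <= A, A <= j & phi A = phi (j + 1)]) ->
  phi l <= phi r.
Proof.
move=> lr; have [d rE] : exists d : nat, r = l + d%:Z by exists `|r - l|%N; lia.
rewrite {r}rE in lr *; elim/ltn_ind: d {lr} => -[|d] IH J; first by rewrite addr0.
have IH' (e : nat) : (e <= d)%N -> phi l <= phi (l + e%:Z).
  by move=> ed; apply: IH => [|j lj je jS]; [lia | apply: J => //; lia].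
have -> : l + d.+1%:Z = l + d%:Z + 1 by lia.
have [dS|dS] := boolP (E (l + d%:Z) \in S2); last exact: le_trans (IH' _ (leqnn d)) (phi_S2 dS).
have [|| A [lA Ad <-]] := J (l + d%:Z) _ _ dS; try lia.
have [e AE] : exists e : nat, A = l + e%:Z by exists `|A - l|%N; lia.
by rewrite AE; apply: IH'; lia.
Qed.

(** As long as psi stays below psi m, an edge of S2 on the arc can be compatible
    with the edge m only through the phi equation, at a point after m. So the falls
    of phi on the arc do not undo its rise at m. *)
Lemma arc_gain m G : E m \in S1 -> m < G -> G <= m + n%:Z ->
  (forall A, m < A -> A < G -> psi A < psi m) -> phi m + 1 <= phi G.
Proof.
move=> mS mG Gn below; rewrite -phi_h; last exact: (subsetP S1h).
apply: phi_jump => [|j mj jG jS]; first by lia.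
have [||A /andP[mA Aj] [AE|AE]] := cS _ _ mS jS; try lia; first by exists A; split=> //; lia.
by have := below A; rewrite AE; lia.
Qed.

(** With a negative drift, the last maximum in a period exceeds all the values of
    the following period. *)
Lemma strict_max_exists : (a2 < c * #|S1|)%N ->
  exists m, forall A, m < A -> A < m + n%:Z -> psi A < psi m.
Proof.
(* The summand i%:Z < n breaks ties in favour of the last maximum. *)
move=> d0; pose g (i : 'I_n) : int := n%:Z * psi i%:Z + i%:Z.
pose i0 : 'I_n := [arg max_(i > ord0) g i]%O.
have gi0 i : g i <= g i0 by rewrite /i0; case: arg_maxP => // j _; apply.
exists i0%:Z => A iA An.
have [A1|A1] := ltrP A n%:Z.
  have lt : (`|A| < n)%N by lia.
  have := gi0 (Ordinal lt); rewrite /g /= (_ : `|A|%:Z = A); last by lia.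
  by nia.
have lt : (`|(A - n%:Z)| < n)%N by have := ltn_ord i0; lia.
have := gi0 (Ordinal lt); rewrite /g /= (_ : `|A - n%:Z|%:Z = A - n%:Z); last by lia.
have := walkDn (vedges D) S1 c (A - n%:Z); rewrite subrK => ->.
by nia.
Qed.

Hypotheses (bal : balanced) (S2f : forall k, k \in S2 -> k \notin record_edges).

(** Starting from the strict maximum, a whole period is one arc, so phi gains over a
    period, where its drift is a1 - b |S2|. *)
Lemma extremal_gt : (a2 < c * #|S1|)%N -> (b * #|S2| < a1)%N.
Proof.
move=> d0; have [m mx] := strict_max_exists d0.
have mS : E m \in S1.
  apply/negPn/negP => mS; have mS1 : psi m <= psi (m + 1).
    have [mv|] := boolP (E m \in vedges D); first by rewrite psi_v; lia.
    by rewrite -hedgesNvedges => mh; rewrite psi_h.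
  have [n1|n1] := ltrP 1 n%:Z; first by have := mx (m + 1); lia.
  have := walkDn (vedges D) S1 c m; rewrite (_ : n%:Z = 1); last by lia.
  by move=> e; move: mS1; rewrite e lerDl subr_ge0 lez_nat leqNgt d0.
have mn : m < m + n%:Z by rewrite ltrDl.
have := arc_gain mS mn (lexx _) mx; rewrite walkDn lerD2l => H.
by rewrite -ltz_nat -subr_gt0; apply: lt_le_trans H.
Qed.

(** The function Om below accumulates a1 c |S1| - a2 b |S2| along the path. Between
    prefix maxima it is constant on edges outside S1, since these are not in S2
    either. On an arc the term in phi gains at least a2, the term in psi does not
    change, and delta grows by less than a2. *)
Lemma extremal_le : S1 != set0 -> (c * #|S1| <= a2)%N -> (a2 * (b * #|S2|) < a1 * (c * #|S1|))%N.
Proof.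
move=> /set0Pn[s sS] d0; have d1 : 0 <= a2%:Z - (c * #|S1|)%:Z by lia.
pose Om m := a2%:Z * phi m - a1%:Z * psi m - delta m.
pose R x y := Om x <= Om y /\ ((exists k, [/\ x <= k, k < y & E k \in S1]) -> Om x < Om y).
have [m mt] := prefix_max_exists d1.
(* The second half of R gives a strict gain, since S1 has an edge in every period. *)
suff [_] : R m (m + n%:Z).
  rewrite /Om deltaDn !walkDn => H.
  suff : a1%:Z * (a2%:Z - (c * #|S1|)%:Z) < a2%:Z * (a1%:Z - (b * #|S2|)%:Z).
    by rewrite mulrBr mulrBr mulrC; lia.
  suff : exists k, [/\ m <= k, k < m + n%:Z & E k \in S1] by move/H; lia.
  exists (m + (cdist (E m) s)%:Z); split; first by rewrite lerDl.
    by have := cdist_lt (E m) s; lia.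
  by rewrite -edge_eqDMn edge_cdist.
apply: (prefix_max_walk (R := R)) => //.
- by move=> x; split=> // -[k [xk kx _]]; lia.
- move=> y x z [xy xyS] [yz yzS]; split; first exact: le_trans yz.
  move=> [k [xk kz kS]]; have [ky|yk] := ltrP k y.
    by apply: lt_le_trans yz; apply: xyS; exists k.
  by apply: le_lt_trans xy _; apply: yzS; exists k.
- move=> p pt pS.
  suff OE : Om (p + 1) = Om p.
    split; first by rewrite OE.
    by move=> [k [pk kp kS]]; move: pS; rewrite (_ : p = k) ?kS //; lia.
  rewrite /Om; have [pv|pv] := boolP (E p \in vedges D).
    have pS2 : E p \notin S2 by apply/negP => /S2f; rewrite prefix_max_record.
    rewrite delta_v // psi_v // walkS (negbTE pS2) hedgesNvedges pv muln0 /=; ring.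
  rewrite delta_h ?hedgesNvedges // psi_h ?hedgesNvedges // phi_h ?hedgesNvedges //; ring.
- move=> p G pt pS pG Gn GE below.
  have gain := arc_gain pS pG Gn below.
  suff OE : Om p < Om G by split=> //; exact: ltW.
  have Gv : E (G - 1) \in vedges D.
    have pG1 : psi (G - 1) < psi p.
      apply: below; last by lia.
      have [e|] := eqVneq (G - 1) p; last by lia.
      by have := psi_S1 pS; rewrite -{1}e subrK GE; lia.
    apply: contraLR pG1; rewrite -hedgesNvedges -leNgt => Gh.
    rewrite -GE; have [GS|GS] := boolP (E (G - 1) \in S1).
      by have := psi_S1 GS; rewrite subrK; lia.
    by have := psi_h Gh GS; rewrite subrK => ->.
  have /andP[_] := bal (subsetP S1h _ pS) Gv; rewrite subrK /Om GE => dG.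
  have : a2%:Z * (phi p + 1) <= a2%:Z * phi G by apply: ler_wpM2l.
  by lia.
- exact: prefix_max_shift.
- by rewrite lerDl.
Qed.
End Extremal.

End FixedS1.

(** * Reversing the path *)

Section Reflection.
Variable n : nat.
(** The reflection in the antidiagonal of the rectangle: the steps are read
    backwards, and East and North are exchanged. *)
Definition rev_path (D : n.-tuple bool) : n.-tuple bool := [tuple ~~ tnth D (rev_ord i) | i < n].
Definition rev_set (S : {set 'I_n}) : {set 'I_n} := [set k | rev_ord k \in S].

Lemma in_rev_set (S : {set 'I_n}) k : (k \in rev_set S) = (rev_ord k \in S).
Proof. by rewrite inE. Qed.
Lemma rev_pathK : involutive rev_path.
Proof. by move=> D; apply: eq_from_tnth => i; rewrite !tnth_mktuple rev_ordK negbK. Qed.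
Lemma rev_setK : involutive rev_set.
Proof. by move=> S; apply/setP => k; rewrite !inE rev_ordK. Qed.
Lemma card_rev_set S : #|rev_set S| = #|S|.
Proof.
rewrite -[RHS](card_imset _ (@rev_ord_inj n)); apply: eq_card => k; rewrite inE.
by rewrite -{2}(rev_ordK k) mem_imset //; apply: rev_ord_inj.
Qed.
Lemma hedges_rev D : hedges (rev_path D) = rev_set (vedges D).
Proof. by apply/setP => k; rewrite !inE tnth_mktuple negbK. Qed.
Lemma vedges_rev D : vedges (rev_path D) = rev_set (hedges D).
Proof. by apply/setP => k; rewrite !inE tnth_mktuple. Qed.
Lemma subset_rev S T : (rev_set S \subset rev_set T) = (S \subset T).
Proof.
apply/subsetP/subsetP => ST k; last by rewrite !inE; apply: ST.
by have := ST (rev_ord k); rewrite !inE rev_ordK.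
Qed.
End Reflection.

Lemma walk_rev n' (U S : {set 'I_n'.+1}) c m : walk (rev_set U) (rev_set S) c m = - walk U S c (- m).
Proof. by rewrite /walk -cum_rev /cum; congr (_ * _ + _); apply: eq_bigr => k _; rewrite !inE. Qed.

(** The walks of the reversed path are m |-> - psi (- m) and m |-> - phi (- m), with
    their roles exchanged, so the two equations of compatibility are exchanged. *)
Lemma compatible_revW n b c (D : n.-tuple bool) S1 S2 :
  compatible b c D S1 S2 -> compatible c b (rev_path D) (rev_set S2) (rev_set S1).
Proof.
case: n D S1 S2 => [|n'] D S1 S2.
  by move=> _; apply/and3P; split; [apply/subsetP => -[] | apply/subsetP => -[] | apply/forallP => -[]].
case/compatibleP => S1h S2v H; apply/compatibleP; rewrite hedges_rev vedges_rev !subset_rev.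
split=> // i j ij jn.
rewrite !inE -!edge_opp => iS jS.
have [||A iAj W] := H _ _ _ _ jS iS; try lia.
exists (- A); first by lia.
rewrite hedges_rev vedges_rev !walk_rev !opprK.
have -> : - (j + 1) = -1 - j by lia.
have -> : - i = -1 - i + 1 by lia.
by case: W => ->; [right | left].
Qed.

Lemma compatible_rev n b c (D : n.-tuple bool) S1 S2 :
  compatible c b (rev_path D) (rev_set S2) (rev_set S1) = compatible b c D S1 S2.
Proof.
apply/idP/idP => [/compatible_revW|]; last exact: compatible_revW.
by rewrite !rev_setK rev_pathK.
Qed.

(** The case n = 0 has no edge to be lifted to the integers. *)
Definition balanced_path n : n.-tuple bool -> Prop :=
  match n with 0%N => fun=> True | n'.+1 => @balanced n' end.

Lemma balanced_path_rev n (D : n.-tuple bool) : balanced_path D -> balanced_path (rev_path D).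
Proof.
case: n D => [//|n'] D /= bal i j; rewrite hedges_rev vedges_rev !in_rev_set -!edge_opp => iv jh.
have dE m : delta (rev_path D) m = delta D (- m).
  rewrite /delta hedges_rev vedges_rev !card_rev_set.
  have -> : set0 = rev_set set0 :> {set 'I_n'.+1} by apply/setP => k; rewrite !inE.
  by rewrite !walk_rev; ring.
have aux (x y p q : int) : - p < x - y < q -> - q < y - x < p by lia.
have := bal _ _ jh iv; rewrite !dE !card_rev_set.
have -> : - (j + 1) = -1 - j by lia.
have -> : -1 - i + 1 = - i by lia.
exact: aux.
Qed.

(** * Factorization of the rows and columns of the coefficient array *)

(** In the order of the exponents of x1 and x2: p counts the vertical edges. *)
Definition num_pairs n (b c : nat) (D : n.-tuple bool) (p q : nat) : nat :=
  #|[set S : {set 'I_n} * {set 'I_n} | [&& compatible b c D S.1 S.2, #|S.2| == p & #|S.1| == q]]|.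

Lemma num_pairs_rev n b c (D : n.-tuple bool) p q : num_pairs c b (rev_path D) q p = num_pairs b c D p q.
Proof.
pose h (S : {set 'I_n} * {set 'I_n}) := (rev_set S.2, rev_set S.1).
have hK : involutive h by case=> S1 S2; rewrite /h /= !rev_setK.
rewrite /num_pairs -[RHS](card_imset _ (inv_inj hK)); apply: eq_card => S.
rewrite -{2}(hK S) mem_imset ?inE; last exact: inv_inj.
by rewrite -{1}[S.1]rev_setK -{1}[S.2]rev_setK compatible_rev /h /= !card_rev_set [X in _ && X]andbC.
Qed.

Lemma num_pairs_large n b c (D : n.-tuple bool) p q :
  (n < p)%N || (n < q)%N -> num_pairs b c D p q = 0%N.
Proof.
move=> pq; apply: eq_card0 => S; rewrite !inE; apply/negP => /and3P[_ /eqP S2p /eqP S1q].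
by have := max_card S.1; have := max_card S.2; rewrite S2p S1q card_ord; lia.
Qed.

(** What is needed from the record edges F of S1, in a form that includes n = 0: F
    can be added to S2 or removed from it, and the pairs with S2 disjoint from F
    satisfy the slope inequality. *)
Definition detachable n (b c : nat) (D : n.-tuple bool) (S1 F : {set 'I_n}) : Prop :=
  [/\ F \subset vedges D, #|F| = (#|vedges D| - c * #|S1|)%N,
      forall S2 : {set 'I_n}, compatible b c D S1 S2 =
        (S2 \subset vedges D) && compatible b c D S1 (S2 :\: F) &
      forall S2 : {set 'I_n}, compatible b c D S1 S2 -> [disjoint S2 & F] -> S1 != set0 ->
        if (c * #|S1| <= #|vedges D|)%N
        then (#|vedges D| * (b * #|S2|) < #|hedges D| * (c * #|S1|))%N
        else (b * #|S2| < #|hedges D|)%N].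

Lemma detachable_exists n (b c : nat) (D : n.-tuple bool) (S1 : {set 'I_n}) :
  (0 < c)%N -> balanced_path D -> S1 \subset hedges D -> exists F, detachable b c D S1 F.
Proof.
case: n D S1 => [|n'] D S1 c0 sl S1h.
  have nil (S : {set 'I_0}) : S = set0 by apply/setP => -[].
  exists set0; split; rewrite ?sub0set ?cards0 //; first by rewrite (nil (vedges D)) cards0.
    by move=> S2; rewrite setD0 [S2]nil sub0set.
  by move=> S2 _ _; rewrite (nil S1) eqxx.
exists (record_edges D c S1); split.
- by apply/subsetP => k; rewrite inE => /andP[].
- exact: card_record_edges.
- by move=> S2; apply: compatible_setD_record.
move=> S2 /compatibleP[_ S2v H] dis S10.
have S2f k : k \in S2 -> k \notin record_edges D c S1 by move=> kS; rewrite (disjointFr dis kS).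
case: ifPn => [cq|]; first exact: (extremal_le c0 S1h S2v H sl S2f S10 cq).
by rewrite -ltnNge => cq; exact: (extremal_gt c0 S1h S2v H cq).
Qed.

Lemma sum_subsets_exp (T : finType) (R : comNzRingType) (W : {set T}) (x : R) :
  \sum_(U : {set T} | U \subset W) x ^+ #|U| = (1 + x) ^+ #|W|.
Proof.
rewrite exprDn (partition_big (fun U : {set T} => inord #|U| : 'I_#|W|.+1) predT) //=.
apply: eq_bigr => i _; rewrite expr1n mul1r -cards_draws -sumr_const.
apply: eq_big => [U|U /andP[UW /eqP <-]]; rewrite ?inE.
  by apply: andb_id2l => UW; rewrite -val_eqE /= inordK // ltnS subset_leq_card.
by rewrite inordK // ltnS subset_leq_card.
Qed.

(** S |-> (S :&: F, S :\: F) is a bijection from the sets that satisfy C to the pairs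
    of any subset of F and a set that satisfies C and is disjoint from F. *)
Lemma sum_setD_exp (T : finType) (R : comNzRingType) (V F : {set T}) (C : pred {set T}) (x : R) :
  F \subset V -> (forall S, C S = (S \subset V) && C (S :\: F)) ->
  \sum_(S | C S) x ^+ #|S| = (1 + x) ^+ #|F| * \sum_(S | C S && [disjoint S & F]) x ^+ #|S|.
Proof.
move=> FV CE; rewrite -sum_subsets_exp big_distrlr /= pair_big_dep /=.
pose h (S : {set T}) := (S :&: F, S :\: F).
pose h' (P : {set T} * {set T}) := P.1 :|: P.2.
have hh' (U S : {set T}) : U \subset F -> [disjoint S & F] -> h (h' (U, S)) = (U, S).
  move=> UF SF; rewrite /h /h' /= setIUl setDUl (setIidPl UF).
  move: (UF); rewrite -setD_eq0 => /eqP ->; rewrite set0U.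
  by move: (SF); rewrite -setI_eq0 => /eqP ->; rewrite setU0 (setDidPl SF).
rewrite (reindex_onto h' h) /=; last by move=> S _; rewrite /h /h' /= setID.
apply: eq_big => [[U S]|[U S]] /=.
  apply/andP/and3P => [[CUS /eqP [UE SE]]|[UF CS SF]].
    split; first by rewrite -UE subsetIr.
    - by move: CUS; rewrite CE SE => /andP[].
    - by rewrite -SE disjoints_subset setDE subsetIr.
  rewrite hh' //; split=> //; rewrite CE.
  have [_ ->] := hh' _ _ UF SF; rewrite CS andbT subUset (subset_trans UF FV) /=.
  by move: CS; rewrite CE => /andP[].
case/andP=> _ /eqP [UE SE]; rewrite -exprD; congr (_ ^+ _).
by rewrite -[LHS](cardsID F) [in X in (X + _)%N]UE SE.
Qed.

(** (b p, c q) lies strictly to the left of the diagonal of the a1 x a2 rectangle,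
    prolonged upwards by a vertical ray, or (p, q) is the origin. *)
Definition left_of_diag b c a1 a2 p q :=
  (p == 0%N) && (q == 0%N) ||
  (if (c * q <= a2)%N then (a2 * (b * p) < a1 * (c * q))%N else (b * p < a1)%N).

Lemma num_pairs_sum n b c (D : n.-tuple bool) q :
  \poly_(p < n.+1) (num_pairs b c D p q)%:Z =
  \sum_(S1 : {set 'I_n} | #|S1| == q) \sum_(S2 | compatible b c D S1 S2) 'X^#|S2| :> {poly int}.
Proof.
apply/polyP => p; rewrite coef_poly pair_big_dep /= coef_sum.
have -> : \sum_(S : {set 'I_n} * {set 'I_n} | (#|S.1| == q) && compatible b c D S.1 S.2)
      ('X^#|S.2| : {poly int})`_p
    = (num_pairs b c D p q)%:Z.
  rewrite /num_pairs -sum1_card (big_morph _ PoszD (erefl _)).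
  rewrite (eq_bigr (fun S : {set 'I_n} * {set 'I_n} => if #|S.2| == p then 1 else 0 : int)); last first.
    by move=> S _; rewrite coefXn eq_sym; case: eqP.
  by rewrite -big_mkcondr; apply: eq_bigl => S; rewrite inE -andbA andbC -andbA.
by case: ltnP => // pn; rewrite num_pairs_large ?pn.
Qed.

Lemma sum_neq0 (I : finType) (P : pred I) (V : nmodType) (G : I -> V) :
  \sum_(i | P i) G i != 0 -> exists2 i, P i & G i != 0.
Proof.
have [i /andP[Pi Gi] _|Z] := pickP [pred i | P i && (G i != 0)]; first by exists i.
rewrite big1 ?eqxx // => i Pi; apply/eqP/negPn/negP => Gi.
by have := Z i; rewrite /= Pi Gi.
Qed.

(** For each S1 with q elements the detachable edges contribute the same power of
    1 + X, and the other factor counts the sets S2 that avoid them. *)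
Lemma row_factor n (b c : nat) (D : n.-tuple bool) q : (0 < c)%N -> balanced_path D ->
  exists Q : {poly int},
  [/\ \poly_(p < n.+1) (num_pairs b c D p q)%:Z = (1 + 'X) ^+ (#|vedges D| - c * q) * Q,
      forall p, 0 <= Q`_p &
      forall p, Q`_p != 0 -> left_of_diag b c #|hedges D| #|vedges D| p q].
Proof.
move=> c0 sl.
have [F FP] : exists F : {set 'I_n} -> {set 'I_n},
    forall S1 : {set 'I_n}, S1 \subset hedges D -> detachable b c D S1 (F S1).
  suff: forall S1 : {set 'I_n}, exists F, S1 \subset hedges D -> detachable b c D S1 F.
    by move/fin_all_exists.
  move=> S1; have [S1h|_] := boolP (S1 \subset hedges D); last by exists set0.
  by have [F ?] := detachable_exists b c0 sl S1h; exists F.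
exists (\sum_(S1 : {set 'I_n} | #|S1| == q)
   \sum_(S2 | compatible b c D S1 S2 && [disjoint S2 & F S1]) 'X^#|S2|); split.
- rewrite num_pairs_sum mulr_sumr; apply: eq_bigr => S1 /eqP qE.
  have [S1h|S1h] := boolP (S1 \subset hedges D); last first.
    rewrite !big_pred0 ?mulr0 // => S2; first by rewrite /compatible (negbTE S1h).
    by rewrite /compatible (negbTE S1h).
  have [Fv Fc CF _] := FP _ S1h.
  by rewrite (sum_setD_exp _ Fv CF) Fc qE.
- move=> p; rewrite coef_sum sumr_ge0 // => S1 _; rewrite coef_sum sumr_ge0 // => S2 _.
  by rewrite coefXn.
move=> p; rewrite coef_sum => /sum_neq0[S1 /eqP qE].
rewrite coef_sum => /sum_neq0[S2 /andP[CS dis]].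
rewrite coefXn; have [pE _|] := eqVneq p #|S2|; last by rewrite eqxx.
have S1h : S1 \subset hedges D by case/and3P: CS.
have [Fv Fc CF ex] := FP _ S1h.
rewrite /left_of_diag pE -qE; have [S0|S10] := eqVneq S1 set0; last first.
  by rewrite ex // orbT.
(* With S1 empty, every vertical edge is detachable, so S2 is empty too. *)
have FE : F S1 = vedges D by apply/eqP; rewrite eqEcard Fv Fc S0 cards0 muln0 subn0 leqnn.
have S2v : S2 \subset vedges D by case/and3P: CS.
move: dis; rewrite FE -setI_eq0 (setIidPl S2v) => /eqP ->.
by rewrite S0 cards0 eqxx.
Qed.

Lemma col_factor n (b c : nat) (D : n.-tuple bool) p : (0 < b)%N -> balanced_path D ->
  exists R : {poly int},
  [/\ \poly_(q < n.+1) (num_pairs b c D p q)%:Z = (1 + 'X) ^+ (#|hedges D| - b * p) * R,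
      forall q, 0 <= R`_q &
      forall q, R`_q != 0 -> left_of_diag c b #|vedges D| #|hedges D| q p].
Proof.
move=> b0 sl; have [R []] := row_factor c p b0 (balanced_path_rev sl).
rewrite hedges_rev vedges_rev !card_rev_set => RE R0 Rs; exists R; split=> //.
by rewrite -RE; apply/polyP => q; rewrite !coef_poly num_pairs_rev.
Qed.

(** The two conditions put the point (b p, c q) strictly on opposite sides of the
    diagonal. *)
Lemma left_of_diag_excl b c a1 a2 p q :
  left_of_diag b c a1 a2 p q -> left_of_diag c b a2 a1 q p -> (p, q) = (0%N, 0%N).
Proof.
rewrite /left_of_diag; case/orP=> [/andP[/eqP -> /eqP ->] //|H].
case/orP=> [/andP[/eqP -> /eqP ->] //|]; move: H.
move: (c * q)%N (b * p)%N => x y; case: (leqP x a2) => xa; case: (leqP y a1) => ya; try lia.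
  by have := leq_mul (leqnn a1) xa; have := leq_mul (leqnn a2) (ltnW ya); lia.
by have := leq_mul (leqnn a1) (ltnW xa); have := leq_mul (leqnn a2) ya; lia.
Qed.

(** * The greedy recursion *)

(** When a <= m the left side is 0 because its upper argument is negative or less
    than k, and the right side because it is k - 1 choose k. *)
Lemma binz_pos_part (a : int) (m k : nat) : (0 < k)%N ->
  binz (a - m%:Z + k%:Z - 1) k = ('C((pos_part a - m) + k - 1, k))%:Z.
Proof.
move=> k0; have [am|am] := ltrP 0 (a - m%:Z).
  have -> : a - m%:Z + k%:Z - 1 = Posz ((pos_part a - m) + k - 1)%N by rewrite /pos_part; lia.
  by [].
have -> : (pos_part a - m = 0)%N by rewrite /pos_part; lia.
rewrite bin_small; last by lia.
have : a - m%:Z + k%:Z - 1 < k by lia.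
by case: (_ - 1) => [r|r] //= rk; rewrite bin_small.
Qed.

(** The convolution of P with the coefficients of the power series (1 + t)^(-N). *)
Definition nbconv (R : comNzRingType) (P : nat -> R) (N p : nat) : R :=
  \sum_(k < p.+1) (-1) ^+ k * P (p - k)%N * ('C(N + k - 1, k))%:R.

(** The product of (1 + t)^(-N-1) with 1 + t, by the Pascal rule. *)
Lemma nbconvS (R : comNzRingType) (P : nat -> R) (N p : nat) :
  nbconv P N p.+1 = nbconv P N.+1 p.+1 + nbconv P N.+1 p.
Proof.
rewrite /nbconv big_ord_recl [in RHS]big_ord_recl -addrA -big_split /=; congr (_ + _).
  by rewrite !addn0 !bin0.
apply: eq_bigr => k _; rewrite /bump /= !add1n subSS !addSn !addnS !subn1 /= binS natrD exprS.
by ring.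
Qed.

Lemma nbconv_inv (R : comNzRingType) (Q : {poly R}) (N p : nat) :
  nbconv (fun i => ((1 + 'X) ^+ N * Q)`_i) N p = Q`_p.
Proof.
elim: N Q p => [|N IH] Q p.
  rewrite expr0 mul1r /nbconv big_ord_recl /= subn0 bin0 expr0 mul1r mulr1 big1 ?addr0 // => k _.
  by rewrite /bump add0n bin_small ?mulr0 //= add1n subn1.
have PE : (1 + 'X) ^+ N.+1 * Q = (1 + 'X) ^+ N * ((1 + 'X) * Q) by rewrite exprSr mulrA.
elim: p => [|p IHp].
  have := IH ((1 + 'X) * Q) 0%N; rewrite /nbconv !big_ord1 -PE subnn !bin0 mulrDl mul1r coefD.
  by rewrite [('X * Q)`_0]coefXM /= addr0.
have := IH ((1 + 'X) * Q) p.+1; rewrite -PE nbconvS IHp mulrDl mul1r coefD coefXM /=.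
by move/addIr.
Qed.

(** The sum in the greedy recursion is, up to sign, the convolution without its term
    k = 0. *)
Lemma nbconvE (P : nat -> int) (N p : nat) :
  P p = nbconv P N p + \sum_(1 <= k < p.+1) (-1) ^+ (k - 1) * P (p - k)%N * ('C(N + k - 1, k))%:Z.
Proof.
rewrite /nbconv big_ord_recl /= subn0 bin0 expr0 mul1r mulr1 big_add1 big_mkord -addrA.
rewrite -big_split big1 ?addr0 //= => k _.
rewrite -[bump 0 k]/k.+1 (_ : (k.+1 - 1)%N = k) ?subn1 // exprS natz.
by move: (Posz _) (P _) => u v; ring.
Qed.

(** By [nbconvE] the two sums in the recursion are e p q - Q`_p and e p q - R`_q, and
    the larger one equals e p q exactly when the smaller coefficient is 0. *)
Lemma greedy_rec_of_factors (b c : nat) (a1 a2 : int) (e : nat -> nat -> int) :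
  (forall p q, (p, q) != (0%N, 0%N) ->
     exists N, exists Q R : {poly int},
     [/\ (p < N)%N, (q < N)%N,
         \poly_(i < N) e i q = (1 + 'X) ^+ (pos_part a2 - c * q) * Q,
         \poly_(i < N) e p i = (1 + 'X) ^+ (pos_part a1 - b * p) * R &
         Num.min Q`_p R`_q = 0]) ->
  greedy_rec b c a1 a2 e.
Proof.
move=> H p q pq; have [N [Q [R [pN qN QE RE]]]] := H p q pq.
have row (g : nat -> int) (d : {poly int}) (m r : nat) : (r < N)%N ->
   \poly_(i < N) g i = (1 + 'X) ^+ m * d -> nbconv g m r = d`_r.
  move=> rN gE; rewrite -(nbconv_inv d m r) /nbconv; apply: eq_bigr => k _.
  by rewrite -gE coef_poly (leq_ltn_trans (leq_subr _ _) rN).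
rewrite -(row _ _ _ _ pN QE) -(row _ _ _ _ qN RE).
set A := \sum_(1 <= k < p.+1) _; set B := \sum_(1 <= k < q.+1) _.
have EA : e p q = nbconv (fun i => e i q) (pos_part a2 - c * q) p + A.
  rewrite {1}(nbconvE (fun i => e i q) (pos_part a2 - c * q)); congr (_ + _).
  by apply: eq_big_nat => k /andP[k0 _]; rewrite binz_pos_part.
have EB : e p q = nbconv (fun i => e p i) (pos_part a1 - b * p) q + B.
  rewrite {1}(nbconvE (fun i => e p i) (pos_part a1 - b * p)); congr (_ + _).
  by apply: eq_big_nat => k /andP[k0 _]; rewrite binz_pos_part.
by move: EA EB; move: (nbconv _ _ _) (nbconv _ _ _) (e p q) => *; lia.
Qed.

(** * The maximal Dyck path stays close to its diagonal *)

Lemma path_pointS n (D : n.-tuple bool) (k : 'I_n) : path_point D k.+1 =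
  if tnth D k then ((path_point D k).1, (path_point D k).2.+1)
  else ((path_point D k).1.+1, (path_point D k).2).
Proof.
rewrite /path_point (take_nth false) ?size_tuple // -cats1 !count_cat /= !addn0 -(tnth_nth false).
by case: (tnth D k) => /=; rewrite ?addn0 ?addn1.
Qed.

Lemma path_point_mono n (D : n.-tuple bool) k l : (k <= l)%N ->
  ((path_point D k).1 <= (path_point D l).1)%N /\ ((path_point D k).2 <= (path_point D l).2)%N.
Proof.
by move=> kl; rewrite /path_point -(subnK kl) addnC takeD !count_cat !leq_addr.
Qed.

(** If the path went East where a step North stays weakly below the diagonal, the
    end of that step North would be a point above the path but not above the
    diagonal. *)
Lemma max_dyck_step (a1 a2 : nat) (D : (a1 + a2).-tuple bool) (k : 'I_(a1 + a2)) : max_dyck_path D ->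
  tnth D k = (a1 * (path_point D k).2.+1 <= a2 * (path_point D k).1)%N.
Proof.
case=> -[Dend below] mx; have kn := ltn_ord k.
have := below k.+1 kn; rewrite path_pointS; case: ifP => kv.
  by rewrite /above_diag -leqNgt.
move=> _; symmetry; apply/negbTE; apply/negP => H.
have [x1 y1] := path_point_mono D (ltnW kn); have [xS _] := path_point_mono D kn.
rewrite Dend in x1 y1 xS; rewrite path_pointS kv /= in xS.
have y2 : ((path_point D k).2 < a2)%N.
  by move: H x1 xS => /=; nia.
have := mx ((path_point D k).1, (path_point D k).2.+1) x1 y2.
rewrite /above_diag /= ltnNge H /=.
suff ab : above_path D ((path_point D k).1, (path_point D k).2.+1) by move/(_ ab).
move=> l ln lx; rewrite [X in (_ < X)%N]/=.
rewrite ltnS; have [lk|kl] := leqP l k; first by case: (path_point_mono D lk).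
have [+ _] := path_point_mono D kl; by rewrite path_pointS kv lx /= ltnn.
Qed.

Lemma path_point_end n (D : n.-tuple bool) : path_point D n = (#|hedges D|, #|vedges D|).
Proof.
rewrite /path_point take_oversize ?size_tuple //; congr (_, _).
  by rewrite -sum1_count big_tuple -sum1_card; apply: eq_bigl => k; rewrite inE.
by rewrite -sum1_count big_tuple -sum1_card; apply: eq_bigl => k; rewrite inE.
Qed.

(** delta increases by a2 at a horizontal edge, decreases by a1 at a vertical one, and
    an edge is vertical exactly when delta >= a1 at its start. So 0 <= delta < a1 + a2
    throughout, delta < a1 where a horizontal edge starts, and delta < a2 where a
    vertical edge ends. *)
Lemma balanced_path_of_step n (D : n.-tuple bool) :
  (forall k : 'I_n, tnth D k =
     (#|hedges D| * (path_point D k).2.+1 <= #|vedges D| * (path_point D k).1)%N) -> balanced_path D.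
Proof.
case: n D => [//|n'] D step.
have a12 : (#|hedges D| + #|vedges D| = n'.+1)%N.
  have -> : hedges D = ~: vedges D by apply/setP => k; rewrite !inE.
  by rewrite addnC cardsC card_ord.
move: step; set a1 := #|hedges D|; set a2 := #|vedges D| => step.
have eo (k : 'I_n'.+1) : edge n' k%:Z = k := edge_ord k.
have dE (k : nat) : (k <= n'.+1)%N ->
    delta D k%:Z = a2%:Z * ((path_point D k).1)%:Z - a1%:Z * ((path_point D k).2)%:Z.
  elim: k => [_|k IH kn]; first by rewrite /delta /walk !cum0 /path_point take0 /= !mulr0.
  rewrite (path_pointS D (Ordinal kn)) (_ : k.+1%:Z = k%:Z + 1); last by rewrite intS addrC.
  have := eo (Ordinal kn); rewrite /= => ek; case: ifP => kv.
    by rewrite delta_v ?ek ?inE // IH 1?ltnW // -/a1 /= ; ring.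
  by rewrite delta_h ?ek ?inE ?kv // IH 1?ltnW // -/a2 /= ; ring.
have vE (k : 'I_n'.+1) : tnth D k = (a1%:Z <= delta D k%:Z).
  rewrite step dE; last exact: ltnW.
  by move: (_.1) (_.2) => x y; nia.
have bnd (k : nat) : (k <= n'.+1)%N -> 0 <= delta D k%:Z < (a1 + a2)%:Z.
  elim: k => [_|k IH kn]; first by rewrite /delta /walk !cum0; lia.
  have := IH (ltnW kn); have := eo (Ordinal kn); have := vE (Ordinal kn).
  rewrite /= (_ : k.+1%:Z = k%:Z + 1); last by rewrite intS addrC.
  case: (boolP (tnth _ _)) => kv dk ek.
    by rewrite delta_v ?ek ?inE // -/a1; lia.
  by rewrite delta_h ?ek ?inE ?kv // -/a2; lia.
move=> i j iv jv.
have [k kE] := edge_lift n' i; have [l lE] := edge_lift n' j.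
have di : delta D i = delta D (edge n' i)%:Z by rewrite kE deltaDMn.
have dj : delta D j = delta D (edge n' j)%:Z by rewrite lE deltaDMn.
rewrite delta_v // di dj -/a1 -/a2.
have := bnd (edge n' i) (ltnW (ltn_ord _)); have := bnd (edge n' j) (ltnW (ltn_ord _)).
have := vE (edge n' i); have := vE (edge n' j).
by move: iv jv; rewrite !inE => /negbTE -> ->; lia.
Qed.

Lemma max_dyck_balanced (a1 a2 : nat) (D : (a1 + a2).-tuple bool) : max_dyck_path D ->
  [/\ balanced_path D, #|hedges D| = a1 & #|vedges D| = a2].
Proof.
move=> mD; have [[Dend _] _] := mD; have := path_point_end D; rewrite Dend => -[h v].
by split=> //; apply: balanced_path_of_step => k; rewrite -h -v; apply: max_dyck_step.
Qed.

(** * Laurent sums with divisible rows and columns *)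

Lemma coef0_exp1X n : ((1 + 'X) ^+ n : {poly int})`_0 = 1.
Proof. by rewrite -horner_coef0 horner_exp !hornerE expr1n. Qed.

Section SubringMembership.
Variables (F : fieldType) (P : F -> Prop).
Hypotheses (P1 : P 1) (PB : forall x y, P x -> P y -> P (x - y)).
Hypothesis PM : forall x y, P x -> P y -> P (x * y).

Lemma closed0 : P 0. Proof. by rewrite -(subrr 1); apply: PB. Qed.
Lemma closedD x y : P x -> P y -> P (x + y).
Proof. by move=> Px Py; rewrite -[y]opprK -[- y]sub0r; apply/PB/PB/Py/closed0. Qed.
Lemma closed_sum (I : Type) (r : seq I) (Q : pred I) (G : I -> F) :
  (forall i, Q i -> P (G i)) -> P (\sum_(i <- r | Q i) G i).
Proof. by move=> H; apply: (big_ind P) => //; [apply: closed0 | apply: closedD]. Qed.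
Lemma closedX x n : P x -> P (x ^+ n).
Proof. by move=> Px; elim: n => [|n IH]; rewrite ?expr0 // exprS; apply: PM. Qed.
Lemma closed_nat n : P n%:R.
Proof. by elim: n => [|n IH]; [apply: closed0 | rewrite -addn1 natrD; apply: closedD]. Qed.
Lemma closed_int (m : int) : P m%:~R.
Proof.
case: m => n; first by rewrite -pmulrn; apply: closed_nat.
by rewrite NegzE mulrNz -pmulrn -sub0r; apply/PB/closed_nat/closed0.
Qed.

Section Monomials.
Variables (x w t : F) (b : nat) (a : int).
Hypotheses (x0 : x != 0) (Px : P x) (Pw : P w) (xw : x * w = t).
(** The power of one initial variable that multiplies the coefficients of index p in
    a pointed expansion; the exponent may be negative. *)
Definition laurent_pow (p : nat) : F := x ^ ((b * p)%:Z - a).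

Lemma laurent_pow_mem p : (pos_part a <= b * p)%N -> P (laurent_pow p).
Proof.
move=> ap; rewrite /laurent_pow; have -> : (b * p)%:Z - a = `|(b * p)%:Z - a|%N
  by rewrite /pos_part in ap; lia.
by rewrite -exprnP; apply: closedX.
Qed.

(** Each factor t = x * w cancels one negative power of x and leaves a factor w. *)
Lemma laurent_pow_neighbour_mem p : P (laurent_pow p * t ^+ (pos_part a - b * p)).
Proof.
have [ap|pa] := leqP (pos_part a) (b * p).
  by rewrite (eqP (_ : _ - _ == 0)%N) ?subn_eq0 // expr0 mulr1; apply: laurent_pow_mem.
rewrite /laurent_pow; set m := (pos_part a - b * p)%N.
have -> : (b * p)%:Z - a = - m%:Z by rewrite /m /pos_part in pa *; lia.
by rewrite -xw exprMn -exprnN mulKf ?expf_neq0 //; apply: closedX.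
Qed.

Lemma laurent_powE p : laurent_pow p = laurent_pow 0 * (x ^+ b) ^+ p.
Proof. by rewrite /laurent_pow muln0 -exprM exprnP -expfzDr //; congr (_ ^ _); ring. Qed.

Lemma laurent_pow_sum (G : {poly int}) N : (size G <= N)%N ->
  \sum_(p < N) (G`_p)%:~R * laurent_pow p = laurent_pow 0 * (map_poly intr G).[x ^+ b].
Proof.
move=> GN; rewrite (@horner_coef_wide _ N) ?(leq_trans (size_poly _ _)) //.
rewrite mulr_sumr; apply: eq_bigr => p _; rewrite coef_map /= laurent_powE; ring.
Qed.

(** 1 + X is invertible as a power series, so G and Q have the same order at 0. *)
Lemma low_coef (G Q : {poly int}) n k : G = (1 + 'X) ^+ n * Q ->
  (forall p, (p < k)%N -> G`_p = 0) -> forall p, (p < k)%N -> Q`_p = 0.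
Proof.
move=> GE G0 p; elim/ltn_ind: p => p IH pk.
have := G0 p pk; rewrite GE coefM big_ord_recl /= subn0 big1 ?addr0; last first.
  by move=> i _; have ip := ltn_ord i; rewrite -[bump 0 i]/i.+1 IH ?mulr0 //; lia.
by rewrite coef0_exp1X mul1r.
Qed.

(** The power of 1 + x^b that divides G compensates the denominator of u, and the
    cofactor Q starts, like G, at a nonnegative power of x. *)
Lemma strip_mem (G Q : {poly int}) (n N : nat) (u : F) :
  (size G <= N)%N -> G = (1 + 'X) ^+ n * Q -> P (u * (1 + x ^+ b) ^+ n) ->
  (forall p, (b * p < pos_part a)%N -> G`_p = 0) ->
  P (\sum_(p < N) (G`_p)%:~R * laurent_pow p * u).
Proof.
move=> GN GE Pu G0; rewrite -mulr_suml laurent_pow_sum // GE.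
rewrite rmorphM rmorphXn rmorphD /= map_polyX rmorph1.
rewrite hornerM horner_exp hornerD hornerX hornerC.
rewrite mulrCA -(laurent_pow_sum (leqnn (size Q))) [_ ^+ n * _]mulrC -mulrA [_ ^+ n * u]mulrC.
apply: PM => //; apply: closed_sum => p _.
have [pa|ap] := ltnP (b * p) (pos_part a); last first.
  by apply: PM; [apply: closed_int | apply: laurent_pow_mem].
have Q0 : Q`_p = 0.
  apply: (low_coef (k := p.+1) GE) => // r rp; apply: G0.
  by apply: leq_ltn_trans pa; rewrite leq_mul2l -ltnS rp orbT.
by rewrite Q0 mul0r; apply: closed0.
Qed.

End Monomials.

Section Membership.
Variables (x0 x1 x2 x3 : F) (b c : nat) (a1 a2 : int).
Hypotheses (x1n : x1 != 0) (x2n : x2 != 0).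
Hypotheses (Px0 : P x0) (Px1 : P x1) (Px2 : P x2) (Px3 : P x3).
Hypotheses (x02 : x0 * x2 = 1 + x1 ^+ b) (x13 : x1 * x3 = 1 + x2 ^+ c).
Hypotheses (b0 : (0 < b)%N) (c0 : (0 < c)%N).
Local Notation A1 := (pos_part a1).
Local Notation A2 := (pos_part a2).
Local Notation y1 := (laurent_pow x1 b a1).
Local Notation y2 := (laurent_pow x2 c a2).
Variable N : nat.
Hypothesis NA : (A1 + A2 < N)%N.

Definition laurent_sum (e : nat -> nat -> int) : F :=
  \sum_(p < N) \sum_(q < N) (e p q)%:~R * (y1 p * y2 q).

Lemma laurent_sumE e : laurent_sum e = x1 ^ (- a1) * x2 ^ (- a2) *
  \sum_(p < N) \sum_(q < N) (e p q)%:~R * x1 ^+ (b * p) * x2 ^+ (c * q).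
Proof.
rewrite mulr_sumr; apply: eq_bigr => p _; rewrite mulr_sumr; apply: eq_bigr => q _.
by rewrite /laurent_pow !expfzDr // -!exprnP; ring.
Qed.

Definition rows (e : nat -> nat -> int) := forall q, exists Q : {poly int},
  \poly_(p < N) e p q = (1 + 'X) ^+ (A2 - c * q) * Q.
Definition cols (e : nat -> nat -> int) := forall p, exists R : {poly int},
  \poly_(q < N) e p q = (1 + 'X) ^+ (A1 - b * p) * R.

(** The product of [corner_row] in x1^b and [corner_col] in x2^c is, up to the
    monomial that normalizes Laurent sums, the expansion of a monomial in the
    variables x0 and x3. Its term of lowest degree is the one of index (p0, q0). *)
Definition corner_row (p0 q0 : nat) : {poly int} := 'X^p0 * (1 + 'X) ^+ (A2 - c * q0).
Definition corner_col (p0 q0 : nat) : {poly int} := 'X^q0 * (1 + 'X) ^+ (A1 - b * p0).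

Lemma y1_neighbour_mem p : P (y1 p * (1 + x2 ^+ c) ^+ (A1 - b * p)).
Proof. exact: laurent_pow_neighbour_mem Px3 x13 _. Qed.

Lemma y2_neighbour_mem q : P (y2 q * (1 + x1 ^+ b) ^+ (A2 - c * q)).
Proof. by apply: laurent_pow_neighbour_mem Px0 _ _ => //; rewrite mulrC. Qed.

(** When no term has both exponents negative, the rows with a negative power of x2
    contain only nonnegative powers of x1 and are handled by [strip_mem]; so are the
    columns with a negative power of x1. The other terms are polynomial. *)
Lemma laurent_sum_corner_free e : rows e -> cols e ->
  (forall p q, (b * p < A1)%N -> (c * q < A2)%N -> e p q = 0) -> P (laurent_sum e).
Proof.
move=> re ce e0.
pose row (q : nat) := \sum_(p < N) (e p q)%:~R * (y1 p * y2 q).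
pose col (p : nat) := \sum_(q < N) (e p q)%:~R * (y1 p * y2 q).
have rowP q : (c * q < A2)%N -> P (row q).
  move=> qA; have [Q QE] := re q.
  have -> : row q = \sum_(p < N) ((\poly_(p < N) e p q)`_p)%:~R * y1 p * y2 q.
    by apply: eq_bigr => p _; rewrite coef_poly ltn_ord mulrA.
  apply: (strip_mem x1n Px1 (size_poly _ _) QE (y2_neighbour_mem q)) => p pA.
  by rewrite coef_poly; case: ifP => // _; apply: e0.
have colP p : (b * p < A1)%N -> P (col p).
  move=> pA; have [R RE] := ce p.
  have -> : col p = \sum_(q < N) ((\poly_(q < N) e p q)`_q)%:~R * y2 q * y1 p.
    by apply: eq_bigr => q _; rewrite coef_poly ltn_ord -mulrA [y2 _ * _]mulrC.
  apply: (strip_mem x2n Px2 (size_poly _ _) RE (y1_neighbour_mem p)) => q qA.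
  by rewrite coef_poly; case: ifP => // _; apply: e0.
have -> : laurent_sum e = \sum_(q < N | (c * q < A2)%N) row q + \sum_(p < N | (b * p < A1)%N) col p
   + \sum_(p < N | ~~ (b * p < A1)%N) \sum_(q < N | ~~ (c * q < A2)%N) (e p q)%:~R * (y1 p * y2 q).
  rewrite /laurent_sum exchange_big (bigID (fun q : 'I_N => (c * q < A2)%N)) /= -addrA; congr (_ + _).
  rewrite exchange_big (bigID (fun p : 'I_N => (b * p < A1)%N)) /=; congr (_ + _).
  apply: eq_bigr => p pA; rewrite /col [RHS](bigID (fun q : 'I_N => (c * q < A2)%N)) /=.
  by rewrite [X in _ = X + _]big1 ?add0r // => q qA; rewrite e0 // mul0r.
apply: closedD; last first.
  apply: closed_sum => p pA; apply: closed_sum => q qA; apply: PM; first exact: closed_int.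
  by apply: PM; apply: laurent_pow_mem => //; rewrite leqNgt.
by apply: closedD; apply: closed_sum => i iA; [apply: rowP | apply: colP].
Qed.

Lemma size_exp1X n : (size ((1 + 'X) ^+ n : {poly int})%R <= n.+1)%N.
Proof.
apply: leq_trans (size_poly_exp_leq _ _) _; rewrite ltnS.
by rewrite addrC -[1]/(1%:P) size_XaddC mul1n.
Qed.

Lemma size_corner_row p0 q0 : (b * p0 < A1)%N -> (size (corner_row p0 q0) <= N)%N.
Proof.
move=> pA; apply: leq_trans (size_polyMleq _ _) _; rewrite size_polyXn.
have p0A : (p0 < A1)%N by apply: leq_ltn_trans pA; rewrite leq_pmull.
by have := size_exp1X (A2 - c * q0); lia.
Qed.

Lemma size_corner_col p0 q0 : (c * q0 < A2)%N -> (size (corner_col p0 q0) <= N)%N.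
Proof.
move=> qA; apply: leq_trans (size_polyMleq _ _) _; rewrite size_polyXn.
have q0A : (q0 < A2)%N by apply: leq_ltn_trans qA; rewrite leq_pmull.
by have := size_exp1X (A1 - b * p0); lia.
Qed.

Lemma coef_shift_exp (i n p : nat) : (p <= i)%N ->
  ('X^i * (1 + 'X) ^+ n : {poly int})`_p = (p == i)%:R.
Proof.
rewrite coefXnM leq_eqVlt => /orP[/eqP ->|pi]; last by rewrite pi ltn_eqF.
by rewrite ltnn subnn coef0_exp1X eqxx.
Qed.

Lemma corner_mem p0 q0 : (b * p0 < A1)%N -> (c * q0 < A2)%N ->
  P (laurent_sum (fun p q => (corner_row p0 q0)`_p * (corner_col p0 q0)`_q)).
Proof.
move=> pA qA; rewrite /laurent_sum.
have -> : \sum_(p < N) \sum_(q < N) ((corner_row p0 q0)`_p * (corner_col p0 q0)`_q)%:~R * (y1 p * y2 q)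
   = (\sum_(p < N) ((corner_row p0 q0)`_p)%:~R * y1 p) *
     (\sum_(q < N) ((corner_col p0 q0)`_q)%:~R * y2 q).
  rewrite big_distrlr /=; apply: eq_bigr => p _; apply: eq_bigr => q _.
  by rewrite intrM; ring.
rewrite !laurent_pow_sum ?size_corner_row ?size_corner_col // /corner_row /corner_col.
rewrite !rmorphM /= !rmorphXn !rmorphD /= !map_polyX !rmorph1.
rewrite !hornerM !horner_exp !hornerD !hornerX !hornerC !mulrA -!laurent_powE //.
have -> : y1 p0 * (1 + x1 ^+ b) ^+ (A2 - c * q0) * y2 0 * (x2 ^+ c) ^+ q0 *
    (1 + x2 ^+ c) ^+ (A1 - b * p0)
   = (y1 p0 * (1 + x2 ^+ c) ^+ (A1 - b * p0)) * (y2 q0 * (1 + x1 ^+ b) ^+ (A2 - c * q0)).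
  rewrite [y2 q0]laurent_powE //; ring.
by apply: PM; [apply: y1_neighbour_mem | apply: y2_neighbour_mem].
Qed.

Lemma sub_corner_row (g : nat -> int) (v : int) p0 n m : (m <= n)%N ->
  (size ('X^p0 * (1 + 'X) ^+ n : {poly int})%R <= N)%N ->
  (exists Q : {poly int}, \poly_(p < N) g p = (1 + 'X) ^+ m * Q) ->
  exists Q : {poly int},
    \poly_(p < N) (g p - v * ('X^p0 * (1 + 'X) ^+ n : {poly int})`_p) = (1 + 'X) ^+ m * Q.
Proof.
move=> mn; set B := 'X^p0 * _ => BN [Q QE].
exists (Q - v *: ('X^p0 * (1 + 'X) ^+ (n - m))).
have -> : \poly_(p < N) (g p - v * B`_p) = \poly_(p < N) g p - v *: B.
  apply/polyP => p; rewrite coefB coefZ !coef_poly; case: ltnP => // Np.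
  by rewrite nth_default ?mulr0 ?subr0 // (leq_trans BN).
by rewrite QE mulrBr -scalerAr mulrCA -exprD subnKC.
Qed.

(** The corner terms, in which both exponents are negative, are removed one at a time
    by subtracting multiples of corner elements. In the order of q * N + p, the
    subtraction at the index k = q0 * N + p0 changes no earlier coefficient. *)
Lemma laurent_sum_mem e : rows e -> cols e -> P (laurent_sum e).
Proof.
move=> re ce.
suff H (j k : nat) : (j + k = N * N)%N -> forall e, rows e -> cols e ->
    (forall p q, (b * p < A1)%N -> (c * q < A2)%N -> (q * N + p < k)%N -> e p q = 0) ->
    P (laurent_sum e).
  by apply: (H (N * N)%N 0%N) => //; rewrite addn0.
elim: j k {e re ce} => [|j IH] k jk e re ce e0.
  apply: laurent_sum_corner_free => // p q pA qA; apply: e0 => //.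
  have pN : (p < N)%N by have := leq_pmull p b0; lia.
  have qN : (q < N)%N by have := leq_pmull q c0; lia.
  by move: jk; rewrite add0n => ->; nia.
pose p0 := (k %% N)%N; pose q0 := (k %/ N)%N.
have N0 : (0 < N)%N by lia.
have kE : k = (q0 * N + p0)%N := divn_eq k N.
have p0N : (p0 < N)%N by rewrite ltn_mod.
have idx p q : (p < N)%N -> (q * N + p < k.+1)%N -> (q * N + p < k)%N \/ (p = p0 /\ q = q0).
  move=> pN; rewrite ltnS leq_eqVlt => /orP[/eqP qk|]; [right | by left].
  by rewrite /p0 /q0 -qk modnMDl divnMDl // modn_small // divn_small // addn0.
have [/andP[pA qA]|nc] := boolP ((b * p0 < A1)%N && (c * q0 < A2)%N); last first.
  apply: (IH k.+1) => //; first by lia.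
  move=> p q pA qA pq; have pN : (p < N)%N by have := leq_pmull p b0; lia.
  case: (idx p q pN pq) => [|[pe qe]]; first exact: e0.
  by move: nc; rewrite -pe -qe pA qA.
pose d (p q : nat) := (corner_row p0 q0)`_p * (corner_col p0 q0)`_q.
pose e' p q := e p q - e p0 q0 * d p q.
have -> : laurent_sum e = laurent_sum e' + (e p0 q0)%:~R * laurent_sum d.
  rewrite /laurent_sum mulr_sumr -big_split; apply: eq_bigr => p _ /=.
  rewrite mulr_sumr -big_split; apply: eq_bigr => q _ /=.
  by rewrite /e' intrB intrM; ring.
apply: closedD; last by apply: PM; [apply: closed_int | apply: corner_mem].
have d1 p : (p < p0)%N -> (corner_row p0 q0)`_p = 0.
  by move=> pp; rewrite coef_shift_exp ?(ltnW pp) // ltn_eqF.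
have d2 q : (q < q0)%N -> (corner_col p0 q0)`_q = 0.
  by move=> qq; rewrite coef_shift_exp ?(ltnW qq) // ltn_eqF.
apply: (IH k.+1); first by lia.
- move=> q; have [qq|qq] := ltnP q q0.
    have [Q QE] := re q; exists Q; rewrite -QE; apply/polyP => p; rewrite !coef_poly.
    by rewrite /e' /d d2 // !mulr0 subr0.
  have [|Q QE] := sub_corner_row (e p0 q0 * (corner_col p0 q0)`_q) _ (size_corner_row q0 pA) (re q).
    by rewrite leq_sub2l // leq_mul2l qq orbT.
  exists Q; rewrite -QE; apply/polyP => p; rewrite !coef_poly; case: ifP => // _.
  by rewrite /e' /d -mulrA [X in _ * X]mulrC.
- move=> p; have [pp|pp] := ltnP p p0.
    have [R RE] := ce p; exists R; rewrite -RE; apply/polyP => q; rewrite !coef_poly.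
    by rewrite /e' /d d1 // mul0r !mulr0 subr0.
  have [|R RE] := sub_corner_row (e p0 q0 * (corner_row p0 q0)`_p) _ (size_corner_col p0 qA) (ce p).
    by rewrite leq_sub2l // leq_mul2l pp orbT.
  exists R; rewrite -RE; apply/polyP => q; rewrite !coef_poly; case: ifP => // _.
  by rewrite /e' /d -mulrA.
- move=> p q pA' qA' pq; have pN : (p < N)%N by have := leq_pmull p b0; lia.
  rewrite /e'; case: (idx p q pN pq) => [pk|[-> ->]]; last first.
    by rewrite /d !coef_shift_exp // !eqxx !mulr1 subrr.
  rewrite e0 // /d; have [pp|pp] := ltnP p p0; first by rewrite d1 // mul0r mulr0 subr0.
  have [qq|qq] := ltnP q q0; first by rewrite d2 // !mulr0 subr0.
  by move: pk; rewrite kE => pk; nia.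
Qed.

End Membership.
End SubringMembership.

(** * The greedy element *)

Lemma num_pairs00 n b c (D : n.-tuple bool) : num_pairs b c D 0 0 = 1%N.
Proof.
rewrite /num_pairs -(cards1 ((set0, set0) : {set 'I_n} * {set 'I_n})); apply: eq_card => -[S1 S2].
rewrite !inE /= !cards_eq0 xpair_eqE [(S2 == _) && _]andbC; apply/andb_idl => /andP[/eqP -> /eqP ->].
by apply/and3P; split; rewrite ?sub0set //; apply/forallP => u; rewrite inE.
Qed.

Lemma compatible_sumE b c (a1 a2 : int) (D : (pos_part a1 + pos_part a2).-tuple bool) N :
  (pos_part a1 + pos_part a2 < N)%N ->
  compatible_sum b c D = x1 ^ (- a1) * x2 ^ (- a2) *
    \sum_(p < N) \sum_(q < N) ((num_pairs b c D p q)%:Z)%:~R * x1 ^+ (b * p) * x2 ^+ (c * q).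
Proof.
move=> nN; rewrite /compatible_sum; congr (_ * _).
set n := (pos_part a1 + pos_part a2)%N in D nN *.
have lt (S : {set 'I_n}) : (#|S| < N)%N.
  by apply: leq_ltn_trans nN; rewrite -[X in (_ <= X)%N]card_ord max_card.
rewrite (partition_big (fun S : {set 'I_n} * {set 'I_n} => Ordinal (lt S.2)) predT) //=.
apply: eq_bigr => p _.
rewrite (partition_big (fun S : {set 'I_n} * {set 'I_n} => Ordinal (lt S.1)) predT) //=.
apply: eq_bigr => q _.
rewrite (eq_bigr (fun=> x1 ^+ (b * p) * x2 ^+ (c * q))); last first.
  by move=> S /andP[/andP[_ /eqP <-] /eqP <-].
rewrite sumr_const -mulrA -pmulrn mulr_natl; congr (_ *+ _).
by apply: eq_card => S; rewrite [LHS]unfold_in !inE /= -andbA.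
Qed.

Lemma double_sum_widen (V : nmodType) (f : nat -> nat -> V) N M : (N <= M)%N ->
  (forall p q, (N <= p)%N || (N <= q)%N -> f p q = 0) ->
  \sum_(p < N) \sum_(q < N) f p q = \sum_(p < M) \sum_(q < M) f p q.
Proof.
move=> NM f0.
have w (g : nat -> V) : (forall i, (N <= i)%N -> g i = 0) -> \sum_(i < N) g i = \sum_(i < M) g i.
  move=> g0; rewrite (big_ord_widen _ _ NM) big_mkcond; apply: eq_bigr => i _.
  by case: ltnP => // /g0.
rewrite (w (fun p => \sum_(q < N) f p q)); last first.
  by move=> i Ni; rewrite big1 // => j _; rewrite f0 ?Ni.
by apply: eq_bigr => p _; apply: w => q Nq; rewrite f0 // Nq orbT.
Qed.

(** The recursion expresses e p q through coefficients with a smaller value of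
    p + q. *)
Lemma greedy_rec_unique b c a1 a2 e e' : e 0%N 0%N = e' 0%N 0%N ->
  greedy_rec b c a1 a2 e -> greedy_rec b c a1 a2 e' -> forall p q, e p q = e' p q.
Proof.
move=> e00 re re' p q; have [m] := ubnP (p + q); elim: m p q => // m IH p q pqm.
have [[-> ->]|pq] := (p, q) =P (0%N, 0%N); first exact: e00.
rewrite re ?re'; try exact/eqP.
by congr Num.max; apply: eq_big_nat => k /andP[k0 kp]; rewrite IH //; lia.
Qed.

Lemma greedy_unique b c a1 a2 x x' : greedy b c a1 a2 x -> greedy b c a1 a2 x' -> x = x'.
Proof.
move=> [e [[_ e0 [N [eN ->]]] re]] [e' [[_ e0' [N' [eN' ->]]] re']].
have ee' := greedy_rec_unique (etrans e0 (esym e0')) re re'.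
congr (_ * _); pose M := maxn N N'.
pose f (e : nat -> nat -> int) p q := (e p q)%:~R * x1 ^+ (b * p) * x2 ^+ (c * q).
rewrite (@double_sum_widen _ (f e) N M) ?leq_maxl //; last by move=> p q H; rewrite /f eN // !mul0r.
rewrite (@double_sum_widen _ (f e') N' M) ?leq_maxr //; last by move=> p q H; rewrite /f eN' // !mul0r.
by apply: eq_bigr => p _; apply: eq_bigr => q _; rewrite /f ee'.
Qed.

Lemma compatible_sum_greedy (b c : nat) (a1 a2 : int)
    (D : (pos_part a1 + pos_part a2)%N.-tuple bool) :
  (0 < b)%N -> (0 < c)%N -> max_dyck_path D -> greedy b c a1 a2 (compatible_sum b c D).
Proof.
move=> b0 c0 mD; have [sl hA vA] := max_dyck_balanced mD.
set n := (pos_part a1 + pos_part a2)%N in D mD sl hA vA *.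
pose e p q := (num_pairs b c D p q)%:Z.
have rowE (q : nat) := row_factor b q c0 sl; have colE (p : nat) := col_factor c p b0 sl.
exists e; split; last first.
  apply: greedy_rec_of_factors => p q pq.
  have [Q [QE Q0 Qs]] := rowE q; have [R [RE R0 Rs]] := colE p.
  pose N := (n + p + q).+1; exists N, Q, R.
  have widen (g : nat -> int) : (forall i, (n < i)%N -> g i = 0) ->
      \poly_(i < N) g i = \poly_(i < n.+1) g i.
    move=> g0; apply/polyP => i; rewrite !coef_poly.
    by have [ni|ni] := leqP n.+1 i; [rewrite g0 // if_same | rewrite (_ : (i < N)%N) // /N; lia].
  split; rewrite /N; try lia.
  - by rewrite -vA -QE; apply: widen => i ni; rewrite /e num_pairs_large ?ni.
  - by rewrite -hA -RE; apply: widen => i ni; rewrite /e num_pairs_large ?ni ?orbT.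
  have [Qz|Qnz] := eqVneq Q`_p 0; first by rewrite Qz; apply/min_idPl.
  have [Rz|Rnz] := eqVneq R`_q 0; first by rewrite Rz; apply/min_idPr.
  by have := left_of_diag_excl (Qs _ Qnz) (Rs _ Rnz) => e0; rewrite e0 eqxx in pq.
have large p q : (n.+1 <= p)%N || (n.+1 <= q)%N -> e p q = 0.
  by move=> H; rewrite /e num_pairs_large.
split; first last.
- by exists n.+1; split=> //; apply: compatible_sumE.
- by rewrite /e num_pairs00.
rewrite (compatible_sumE _ _ _ (ltnSn _)).
have x1n : x1 != 0 := posf_neq0 posf_x1.
have x2n : x2 != 0 := posf_neq0 posf_x2.
have gen m : cluster_algebra b c (cluster_var b c m) by apply: subring_gen_in; exists m.
have := @laurent_sum_mem _ (cluster_algebra b c) (subring_gen1 _) (@subring_genB _ _) (@subring_genM _ _)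
  (cluster_var b c 0) x1 x2 (cluster_var b c 3) b c a1 a2 x1n x2n (gen 0) (gen 1) (gen 2) (gen 3).
rewrite ![1 + _]addrC.
move=> /(_ (cluster_var_exchange b c 1) (cluster_var_exchange b c 2) b0 c0 n.+1 (ltnSn _) e).
rewrite (laurent_sumE b c a1 a2 x1n x2n).
apply.
- by move=> q; have [Q [QE _ _]] := rowE q; exists Q; rewrite -vA.
- by move=> p; have [R [RE _ _]] := colE p; exists R; rewrite -hA.
Qed.

Local Close Scope ring_scope.

Theorem theorem1p11 (b c : nat) (a1 a2 : int)
    (D : (pos_part a1 + pos_part a2).-tuple bool) :
  (0 < b)%N -> (0 < c)%N -> max_dyck_path D ->
  unique (greedy b c a1 a2) (compatible_sum b c D).
Proof.
move=> b0 c0 mD; have G := compatible_sum_greedy b0 c0 mD.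
by split=> // x'; apply: greedy_unique.
Qed.
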